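(* Let $\mathbb K$ be a field, $\mathbb P=\mathbb K[x_1,\dots,x_n]$, $f=(f_1,\dots,f_d)\in\mathbb P^d$, and let $\prec_m$ and $\prec_s$ be compatible admissible orders on $\mathbb P$ and $\mathbb P^d$. Then all TRB pairs (up to equivalence) are calculated by the TRB-MJ algorithm with input $f$ and stored to $DONE$.
   Context: Basic notions. $M$ is the set of monomials of $\mathbb P$; a monomial of $\mathbb P^d$ is $mE_i$ with $m\in M$ and $E_i$ the $i$-th unit vector; $s\mid s'$ for monomials of $\mathbb P^d$ means $s'=ms$ for some $m\in M$. $\prec_m$, $\prec_s$ are admissible orders on $\mathbb P$, $\mathbb P^d$ (total orders on monomials compatible with multiplication by $M$, with $1\prec_m m$ for $1\ne m\in M$, resp. $s\prec_s ms$). They are compatible if for all monomials $s_1,s_2$ of $\mathbb P^d$ and $m_1,m_2\in M$, $s_1\preceq_s s_2$ and $m_1\preceq_m m_2$ imply $s_1m_1\preceq_s s_2m_2$, with equality iff $s_1=s_2$ and $m_1=m_2$ (equivalently, restricting $\prec_s$ to each component $\{mE_i\}$ gives $\prec_m$). Conventionally $lm(0)=0$ and $0$ is smaller than every monomial. Leading monomials/terms/coefficients are taken with respect to $\prec_m$ on $\mathbb P$ and $\prec_s$ on $\mathbb P^d$. A pair is $p=(u,v)\in\mathbb P^d\times\mathbb P$ with $u\cdot f=v$; $lm(p)=lm(v)$, $lt(p)=lt(v)$, $sig(p)=lm(u)$. $(u_1,v_1)\prec_p(u_2,v_2)$ iff $lm(v_1)lm(u_2)\prec_s lm(v_2)lm(u_1)$.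 $p_1\equiv p_2$ (equivalent) iff $sig(p_1)=sig(p_2)$ and $lm(p_1)=lm(p_2)$. $p_1\sim p_2$ (similar) iff $lm(p_1)sig(p_2)=lm(p_2)sig(p_1)$. $p$ is syzygy if $lm(p)=0$; a signature is syzygy if it is the signature of a syzygy pair. $p_1$ is top reducible by $p_2$ if both are non-syzygy, $p_1\prec_p p_2$ and $lm(p_2)\mid lm(p_1)$; the top reduction replaces $p_1$ by $p_1-\frac{lt(p_1)}{lt(p_2)}p_2$. A non-syzygy pair that cannot be top reduced by any pair is a TRP pair. The TRP similar set of $p$ is the set of all TRP pairs similar to $p$. A TRB pair is a TRP pair $p'$ such that $sig(p')$ is not properly divisible by any signature of a pair in the same TRP similar set. Multiplied pairs. A multiplied pair $[m,p]$ is an element of $M\times PAIR$ ($PAIR$ the set of all pairs); its value is $mp$ and $sig([m,p])=sig(mp)$; ''signed $s$'' means having signature $s$. For two non-similar non-syzygy pairs $p_1,p_2$, their J-pair is $[m,p]$ with $p$ the $\prec_p$-smaller of $p_1,p_2$ and $m=lcm(lm(p_1),lm(p_2))/lm(p)$. For a set $PS$ of pairs, $[m_0,p_0]\in M\times PS$ is an M-pair of $PS$ signed $s$ if $s=sig(m_0p_0)$, $m_0\neq1$, and for all $[m,p]\in M\times PS$ signed $s$ with $m\neq 1$ and $p\not\equiv p_0$ one has $p_0\prec_p p$, or $p_0\sim p$ and $sig(p_0)\succ_s sig(p)$. TRB-MJ algorithm. Step 0: $DONE:=\emptyset$, $TODO:=\{[1,(E_i,f_i)]: i=1,\dots,d\}$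 (the initial multiplied pairs). Step 1: if $TODO=\emptyset$ output $DONE$; otherwise select (and remove from $TODO$) a multiplied pair $[m,p]$ with smallest signature with respect to $\prec_s$. Step 2: if $[m,p]$ meets one of the MJCriterions, go to Step 1; otherwise let $p'$ be obtained from $mp$ by performing top reductions by elements of $DONE$ until the result cannot be top reduced by $DONE$ (TopReductions). Step 3: unless $p'$ is non-initial and equivalent to $mp$ (CheckStore), add to $TODO$ all J-pairs of $p'$ with $p''\in DONE$ (none if the two pairs are similar or one is syzygy), and then add $p'$ to $DONE$; go to Step 1. The MJCriterions are: the GSyzygy Criterion, met by $[m,p]$ if $sig(mp)$ is divisible by a syzygy signature in $DONE$ or by some $\max(sig(v_2p_1),sig(v_1p_2))$ with $p_i=(u_i,v_i)\in DONE$ and $sig(v_2p_1)\neq sig(v_1p_2)$; and the Mpair Criterion, met by $[m,p]$ if $[m,p]$ is neither initial nor an M-pair of $DONE$. *)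

(* Defs.v *)
From mathcomp Require Import all_boot all_order all_algebra.
From mathcomp Require Import finmap.
From mathcomp.multinomials Require Import mpoly.

Set Implicit Arguments.
Unset Strict Implicit.
Unset Printing Implicit Defensive.

Import GRing.Theory.

Local Open Scope ring_scope.

(* The monomial m E_i of P^d is encoded as (i, m).  The monomials of P are
   written additively by the multinomials library: [m1 + m2] is the product,
   [0] is the monomial 1, and [(m1 <= m2)%MM] is divisibility. *)
Notation smonom d n := ('I_d * 'X_{1..n})%type.

Section Monomials.
Variables d n : nat.
Implicit Types (m : 'X_{1..n}) (s : smonom d n).

Definition smul m s : smonom d n := (s.1, (m + s.2)%MM).

Definition smdvd s s' : bool := (s.1 == s'.1) && (s.2 <= s'.2)%MM.

Record admissible_m (leM : rel 'X_{1..n}) : Prop := AdmissibleM {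
  leM_refl : reflexive leM;
  leM_anti : antisymmetric leM;
  leM_trans : transitive leM;
  leM_total : total leM;
  leM_mul : forall m m1 m2, leM m1 m2 -> leM (m + m1)%MM (m + m2)%MM;
  leM_one : forall m, m != 0%MM -> leM 0%MM m && (0%MM != m)
}.

Record admissible_s (leS : rel (smonom d n)) : Prop := AdmissibleS {
  leS_refl : reflexive leS;
  leS_anti : antisymmetric leS;
  leS_trans : transitive leS;
  leS_total : total leS;
  leS_mul : forall m s1 s2, leS s1 s2 -> leS (smul m s1) (smul m s2);
  leS_one : forall m s, m != 0%MM -> leS s (smul m s) && (s != smul m s)
}.

Definition compatible_orders (leM : rel 'X_{1..n}) (leS : rel (smonom d n)) :
    Prop :=
  forall s1 s2 m1 m2, leS s1 s2 -> leM m1 m2 ->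
    leS (smul m1 s1) (smul m2 s2) /\
    (smul m1 s1 = smul m2 s2 <-> s1 = s2 /\ m1 = m2).

End Monomials.

(* Leading monomials live in [option], with [None] standing for lm(0) = 0,
   which is smaller than every monomial and absorbing for multiplication. *)
Section ZeroExtension.
Variables (T : eqType) (le : rel T).

Definition ole (x y : option T) : bool :=
  match x, y with
  | None, _ => true
  | Some _, None => false
  | Some a, Some b => le a b
  end.

Definition olt (x y : option T) : bool := ole x y && (x != y).

Definition omax (x y : option T) : option T := if ole x y then y else x.

Definition max_of (s : seq T) : option T := foldr (fun a => omax (Some a)) None s.

End ZeroExtension.

Definition osmul d n (m : option 'X_{1..n}) (s : option (smonom d n)) :
    option (smonom d n) :=
  match m, s with Some m, Some s => Some (smul m s) | _, _ => None end.

Definition odvd T (dvd : rel T) (x y : option T) : bool :=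
  match x, y with Some a, Some b => dvd a b | _, _ => false end.

(* (u, v); the condition u . f = v is the predicate [is_pair] below. *)
Notation uvec K n d := ('rV[{mpoly K[n]}]_d * {mpoly K[n]})%type.
(* The multiplied pair [m, p]. *)
Notation mpair K n d := (multinom n * uvec K n d)%type.

Section Pairs.
Variables (K : fieldType) (n d : nat).

Local Notation P := {mpoly K[n]}.
Local Notation Pd := 'rV[{mpoly K[n]}]_d.
Local Notation M := 'X_{1..n}.
Local Notation uvec := (uvec K n d).
Local Notation mpair := (mpair K n d).

Variables (f : Pd) (leM : rel M) (leS : rel (smonom d n)).

Implicit Types (p q : uvec) (w : mpair) (D : {fset uvec}) (T : {fset mpair}).

Definition is_pair p : Prop := \sum_(i < d) p.1 0 i * f 0 i = p.2.

Definition lmP (v : P) : option M := max_of leM (msupp v).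

Definition lmPd (u : Pd) : option (smonom d n) :=
  max_of leS [seq (i, m) | i <- enum 'I_d, m <- msupp (u 0 i)].

Definition lm p : option M := lmP p.2.
Definition sig p : option (smonom d n) := lmPd p.1.
Definition lc p : K := if lm p is Some m then p.2@_m else 0.

Definition pscale (a : P) p : uvec := (a *: p.1, a * p.2).

Definition ltp p1 p2 : bool :=
  olt leS (osmul (lm p1) (sig p2)) (osmul (lm p2) (sig p1)).

Definition equivalent p1 p2 : bool := (sig p1 == sig p2) && (lm p1 == lm p2).

Definition similar p1 p2 : bool :=
  osmul (lm p1) (sig p2) == osmul (lm p2) (sig p1).

Definition syzygy p : bool := lm p == None.

Definition top_reducible p1 p2 : bool :=
  [&& ~~ syzygy p1, ~~ syzygy p2, ltp p1 p2
    & odvd (fun m1 m2 => (m1 <= m2)%MM) (lm p2) (lm p1)].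

Definition top_reduction p1 p2 : uvec :=
  if (lm p1, lm p2) is (Some m1, Some m2) then
    let t : P := (lc p1 / lc p2) *: 'X_[(m1 - m2)%MM] in
    (p1.1 - t *: p2.1, p1.2 - t * p2.2)
  else p1.

Definition is_TRP p : Prop :=
  [/\ is_pair p, ~~ syzygy p & forall q, is_pair q -> ~~ top_reducible p q].

Definition proper_smdvd (s s' : smonom d n) : bool := smdvd s s' && (s != s').

Definition is_TRB p : Prop :=
  is_TRP p /\
  forall q, is_TRP q -> similar q p -> ~~ odvd proper_smdvd (sig q) (sig p).

Definition mval w : uvec := pscale 'X_[w.1] w.2.

Definition msig w : option (smonom d n) := sig (mval w).

Definition jpair p1 p2 : option mpair :=
  if similar p1 p2 then None else
  if (lm p1, lm p2) is (Some m1, Some m2) then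
    if ltp p1 p2 then Some ((mlcm m1 m2 - m1)%MM, p1)
    else Some ((mlcm m1 m2 - m2)%MM, p2)
  else None.

Definition is_Mpair_signed (PS : {fset uvec}) (s : option (smonom d n)) w :
    Prop :=
  [/\ w.2 \in PS, s = msig w, w.1 != 0%MM &
    forall w', w'.2 \in PS -> msig w' = s -> w'.1 != 0%MM ->
      ~~ equivalent w'.2 w.2 ->
      ltp w.2 w'.2 || similar w.2 w'.2 && olt leS (sig w'.2) (sig w.2)].

Definition is_Mpair (PS : {fset uvec}) w : Prop :=
  is_Mpair_signed PS (msig w) w.

Definition init_pair (i : 'I_d) : uvec := (delta_mx 0 i, f 0 i).

Definition initial_pair p : bool := [exists i, p == init_pair i].

Definition init_mpair (i : 'I_d) : mpair := (0%MM, init_pair i).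

Definition initial_mpair w : bool := [exists i, w == init_mpair i].

Definition gsyzygy_criterion (D : {fset uvec}) w : Prop :=
  (exists2 p, p \in D & syzygy p && odvd (@smdvd d n) (sig p) (msig w)) \/
  (exists p1 p2, [/\ p1 \in D, p2 \in D,
     sig (pscale p1.2 p2) <> sig (pscale p2.2 p1) &
     odvd (@smdvd d n)
       (omax leS (sig (pscale p2.2 p1)) (sig (pscale p1.2 p2))) (msig w)]).

Definition Mpair_criterion (D : {fset uvec}) w : Prop :=
  ~ initial_mpair w /\ ~ is_Mpair D w.

Definition MJ_criterion (D : {fset uvec}) w : Prop :=
  gsyzygy_criterion D w \/ Mpair_criterion D w.

(* [current = None] at Step 1; [current = Some (w, q)] while the value of the
   selected multiplied pair w is being top reduced, q being its present value *)
Record state := State {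
  TODO : {fset mpair};
  DONE : {fset uvec};
  current : option (mpair * uvec)
}.

Definition init_state : state :=
  State [fset init_mpair i | i : 'I_d]%fset fset0 None.

Definition jpairs p (D : {fset uvec}) : {fset mpair} :=
  [fset w in pmap (jpair p) (enum_fset D)]%fset.

(* The algorithm is nondeterministic in the choice among multiplied pairs of
   smallest signature and in the choice of the reductors. *)
Inductive step : state -> state -> Prop :=
| StepDiscard T D w :
    w \in T -> (forall w', w' \in T -> ole leS (msig w) (msig w')) ->
    MJ_criterion D w ->
    step (State T D None) (State (T `\ w)%fset D None)
| StepSelect T D w :
    w \in T -> (forall w', w' \in T -> ole leS (msig w) (msig w')) ->
    ~ MJ_criterion D w ->
    step (State T D None) (State (T `\ w)%fset D (Some (w, mval w)))
| StepReduce T D w q r :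
    r \in D -> top_reducible q r ->
    step (State T D (Some (w, q))) (State T D (Some (w, top_reduction q r)))
| StepDrop T D w q :
    (forall r, r \in D -> ~~ top_reducible q r) ->
    ~~ initial_pair q && equivalent q (mval w) ->
    step (State T D (Some (w, q))) (State T D None)
| StepStore T D w q :
    (forall r, r \in D -> ~~ top_reducible q r) ->
    ~~ (~~ initial_pair q && equivalent q (mval w)) ->
    step (State T D (Some (w, q)))
         (State (T `|` jpairs q D)%fset (q |` D)%fset None).

(* Maximal executions: a run may only stutter where no step is possible, so
   that finite and infinite executions are both covered. *)
Definition TRBMJ_run (st : nat -> state) : Prop :=
  st 0%N = init_state /\
  forall k, step (st k) (st k.+1) \/
            (forall s, ~ step (st k) s) /\ st k.+1 = st k.

End Pairs.

(* Main.v *)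
Require Import Defs.
From mathcomp Require Import all_boot all_order all_algebra.
From mathcomp Require Import finmap.
From mathcomp.multinomials Require Import mpoly.
From Stdlib Require Import ClassicalEpsilon.

(** Only the signature and the leading monomial of a pair matter, and top
    reducing [q] by [r] is possible exactly when some multiple of [r] has the
    leading monomial of [q] and a smaller signature.

    Multiplied pairs are processed by nondecreasing signature.  When [q] is
    stored, every J-pair it creates has a strictly larger signature, so each
    signature is stored at most once.  If the pair [q] being stored were
    divisible, in signature and in leading monomial, by a stored [r], then
    irreducibility of [q] would make the multiple of [r] with the signature of
    [q] have at most the leading monomial of [q], whereas the M-pair just
    processed has the least leading monomial among such multiples; [q] would
    then be equivalent to it and be dropped.  By Dickson's lemma the run stops.

    At the end every TRP pair [p] is equivalent to a multiple of a stored pair,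
    by induction on its signature [s].  Choose [m r] of signature [s] with [r]
    stored, first with the least leading monomial, then with the least [m].  If
    [m r] were not equivalent to [p], some stored [r2] would reduce it, and the
    J-pair of [r] and [r2] divides [m r]; whichever way that J-pair was
    processed contradicts the choice of [m r]. *)

Set Implicit Arguments.
Unset Strict Implicit.
Unset Printing Implicit Defensive.

Import GRing.Theory.

(** * Dickson's lemma and the existence of minima *)

Lemma tail_minimum (g : nat -> nat) N :
  exists k, N <= k /\ forall k', k <= k' -> g k <= g k'.
Proof.
have [m] := ubnP (g N); elim: m N => // m IH N; rewrite ltnS => gNm.
case: (classic (exists k', N <= k' /\ g k' < g N)) => [[k' [Nk' gk']]|nex].
  have [k [k'k kmin]] := IH k' (leq_trans gk' gNm).
  by exists k; split; first exact: leq_trans k'k.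
exists N; split=> // k' Nk'; rewrite leqNgt; apply/negP => gk'.
by apply: nex; exists k'.
Qed.

(** Each chosen index is a minimum of [g] over a tail that contains all later choices, so the chosen
    values cannot decrease. *)
Lemma nondecreasing_subseq (g : nat -> nat) :
  exists2 h : nat -> nat, {homo h : i j / i < j} &
    {homo (fun i => g (h i)) : i j / i <= j}.
Proof.
pose F N := constructive_indefinite_description _ (tail_minimum g N).
pose f N := sval (F N).
have fge N : N <= f N by case: (svalP (F N)).
have fmin N k : f N <= k -> g (f N) <= g k by case: (svalP (F N)) => _; apply.
pose h := fix h i := if i is i'.+1 then f (h i').+1 else f 0.
have hS i : h i < h i.+1 by exact: fge.
have hlt : {homo h : i j / i < j} by apply: homo_ltn => //; exact: ltn_trans.
exists h => //; apply: homo_leq => // [? ? ?|i]; first exact: leq_trans.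
have := ltnW (hS i); case: i => [|i] /=; exact: fmin.
Qed.

(** The coordinates are treated one at a time; passing to a further subsequence keeps those already
    made monotone. *)
Lemma nondecreasing_subseqs (I : finType) (g : nat -> I -> nat) :
  exists2 h : nat -> nat, {homo h : i j / i < j} &
    forall x, {homo (fun i => g (h i) x) : i j / i <= j}.
Proof.
suff [h hlt hle] : exists2 h : nat -> nat, {homo h : i j / i < j} &
    forall x, x \in enum I -> {homo (fun i => g (h i) x) : i j / i <= j}.
  by exists h => // x; apply: hle; rewrite mem_enum.
elim: (enum I) => [|y r [h hlt hle]]; first by exists id.
have [k klt kle] := nondecreasing_subseq (fun i => g (h i) y).
exists (h \o k) => [i j ij /=|x]; first exact/hlt/klt.
rewrite inE => /predU1P[-> //|xr] i j ij /=; apply: hle => //.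
exact: (ltnW_homo klt).
Qed.

Lemma dickson (I : finType) (g : nat -> I -> nat) :
  exists i j, i < j /\ forall x, g i x <= g j x.
Proof.
have [h hlt hle] := nondecreasing_subseqs g.
by exists (h 0), (h 1); split=> [|x]; [exact: hlt|exact: hle].
Qed.

(** Dependent choice: without a minimal element, iterated choice of smaller elements gives an
    infinite descent. *)
Lemma exists_minimal (T : Type) (lt : T -> T -> Prop) :
  (forall g : nat -> T, ~ forall i, lt (g i.+1) (g i)) ->
  forall P : T -> Prop, (exists x, P x) ->
  exists x, P x /\ forall y, P y -> ~ lt y x.
Proof.
move=> wf P [x0 Px0]; apply: NNPP => nomin.
have next (x : {x | P x}) : exists y : {y | P y}, lt (sval y) (sval x).
  apply: NNPP => nex; apply: nomin; exists (sval x); split; first exact: svalP.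
  by move=> y Py ltyx; apply: nex; exists (exist _ y Py).
pose nx x := sval (constructive_indefinite_description _ (next x)).
have nxP x : lt (sval (nx x)) (sval x).
  exact: (svalP (constructive_indefinite_description _ (next x))).
by apply: (wf (fun i => sval (iter i nx (exist _ x0 Px0)))) => i; exact: nxP.
Qed.

Lemma good_minimum (T : Type) (le : rel T) :
  transitive le -> total le ->
  (forall g : nat -> T, exists i j, i < j /\ le (g i) (g j)) ->
  forall P : T -> Prop, (exists x, P x) ->
  exists x, P x /\ forall y, P y -> le x y.
Proof.
move=> trans tot good P exP.
have [g desc|x [Px xmin]] :=
    @exists_minimal T (fun x y => ~~ le y x) _ P exP; last first.
  by exists x; split=> // y /xmin/negP; rewrite negbK.
have [i [j [ij]]] := good g; apply/negP.
(* By totality the negated converse of [le] is transitive, so descent between neighbours gives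
   descent between any two indices. *)
apply: (@homo_ltn T g (fun x y => ~~ le x y)) ij => // y x z nxy nyz.
apply: contra nxy => xz; apply: (trans _ _ _ xz).
by have := tot y z; rewrite (negbTE nyz).
Qed.

Local Open Scope ring_scope.

(** * Leading terms of coefficient functions over a total order *)

Section Lead.
Variables (T : eqType) (le : rel T).
Hypotheses (le_refl : reflexive le) (le_anti : antisymmetric le).
Hypotheses (le_trans : transitive le) (le_total : total le).

Lemma not_leE x y : ~~ le x y = (y != x) && le y x.
Proof.
have [->|yx] /= := eqVneq y x; first by rewrite le_refl.
have := le_total x y; case xy: (le x y) => //= _.
by apply/esym/negP => yx'; case/eqP: yx; apply: le_anti; rewrite yx' xy.
Qed.

Lemma ole_refl : reflexive (ole le).
Proof. by case=> [x|] //=. Qed.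

Lemma ole_trans : transitive (ole le).
Proof. by move=> [y|] [x|] [z|] //=; exact: le_trans. Qed.

Lemma ole_total : total (ole le).
Proof. by move=> [x|] [y|] //=; exact: le_total. Qed.

Lemma ole_anti : antisymmetric (ole le).
Proof. by move=> [x|] [y|] //= /le_anti ->. Qed.

Lemma oltE x y : olt le x y = ~~ ole le y x.
Proof.
rewrite /olt; case: x y => [x|] [y|] //=; rewrite not_leE andbC.
by congr (_ && _).
Qed.

Lemma oltS x y : olt le (Some x) (Some y) = ~~ le y x.
Proof. by rewrite oltE. Qed.

Lemma max_ofP s :
  if max_of le s is Some t then t \in s /\ forall t', t' \in s -> le t' t
  else s = [::].
Proof.
elim: s => //= x s; case: (max_of le s) => [t [ts tmax]|->]; last first.
  by rewrite /omax /= mem_seq1; split=> // t'; rewrite mem_seq1 => /eqP->.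
rewrite /omax /=; case xt: (le x t); split; rewrite ?inE ?ts ?orbT ?eqxx //.
  by move=> t'; rewrite inE => /predU1P[->|/tmax].
move=> t'; rewrite inE => /predU1P[->//|/tmax t't]; apply: le_trans t't _.
by move: (le_total x t); rewrite xt.
Qed.

Variable K : idomainType.
Implicit Types (c : T -> K) (o : option T).

(** Polynomials and vectors of polynomials are both seen as coefficient functions on a totally
    ordered set of monomials, so that cancellation is proved once for both. *)
Definition is_lead c o : Prop :=
  if o is Some t then c t <> 0 /\ forall t', c t' <> 0 -> le t' t
  else forall t, c t = 0.

Lemma is_lead_unique c o o' : is_lead c o -> is_lead c o' -> o = o'.
Proof.
case: o o' => [t|] [t'|] //=.
- move=> [ct tmax] [ct' t'max]; congr Some; apply: le_anti.
  by rewrite t'max // tmax.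
- by move=> [ct _] /(_ t).
- by move=> /(_ t') ? [].
Qed.

(** Every index in the support of [c'] lies strictly below the leading index of [c], so [c']
    vanishes there. *)
Lemma is_lead_subl c c' o o' :
  is_lead c o -> is_lead c' o' -> olt le o' o ->
  is_lead (fun t => c t - c' t) o.
Proof.
case: o => [t|]; last by case: o'.
move=> [ct tmax] lead'; rewrite oltE => lt'.
have c't t' : c' t' <> 0 -> le t' t /\ t' <> t.
  case: o' lead' lt' => [t''|] /=; last by move=> ->.
  move=> [_ max''] lt' /max'' t't''; split.
    by apply: le_trans t't'' _; have := le_total t'' t;
      rewrite (negbTE lt') orbF.
  by move=> tt'; rewrite -tt' t't'' in lt'.
have c't0 : c' t = 0 by apply/eqP/negP => /negP/eqP/c't[].
split; first by rewrite c't0 subr0.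
move=> t' /eqP ne; have [ct'0|/eqP/tmax//] := eqVneq (c t') 0.
by apply: (c't t' _).1 => c't'0; case/eqP: ne; rewrite ct'0 c't'0 subr0.
Qed.

Lemma is_lead_sub_lt c c' t o :
  is_lead c (Some t) -> is_lead c' (Some t) -> c t = c' t ->
  is_lead (fun t => c t - c' t) o -> olt le o (Some t).
Proof.
move=> [_ tmax] [_ tmax'] ctt; case: o => [t'|] // [ne _].
rewrite oltS not_leE; apply/andP; split.
  by apply/eqP => tt'; apply: ne; rewrite tt' ctt subrr.
have [ct'0|/eqP/tmax//] := eqVneq (c t') 0.
by apply: tmax' => c't'0; apply: ne; rewrite ct'0 c't'0 subr0.
Qed.

(** Here [h] stands for multiplication by a monomial and [a] for a scalar; [h] the identity and
    [a = -1] give negation. *)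
Lemma is_lead_shift c c' o (h : T -> T) (a : K) :
  a != 0 -> (forall x y, le x y -> le (h x) (h y)) ->
  (forall t, c' (h t) = a * c t) ->
  (forall t', c' t' <> 0 -> exists t, t' = h t) ->
  is_lead c o -> is_lead c' (omap h o).
Proof.
move=> a0 hmono c'h hsurj; case: o => [t [ct tmax]|c0] /=.
  split; first by rewrite c'h => /eqP; rewrite mulf_eq0 (negbTE a0) => /eqP.
  move=> t' /[dup] /hsurj [t'' ->]; rewrite c'h => ne.
  by apply/hmono/tmax => ct0; apply: ne; rewrite ct0 mulr0.
move=> t'; apply/eqP/negP => /negP/eqP/[dup]/hsurj[t ->].
by rewrite c'h c0 mulr0.
Qed.

Lemma is_lead_ext c c' o : c =1 c' -> is_lead c o -> is_lead c' o.
Proof.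
by move=> e; case: o => [t [ct tm]|c0] /=; [split=> [|t']|move=> t];
  rewrite -e // => /tm.
Qed.

End Lead.

(** * Leading monomials in [P] and [P^d] *)

Section Leading.
Variables (K : fieldType) (n d : nat).
Local Notation P := {mpoly K[n]}.
Local Notation Pd := 'rV[{mpoly K[n]}]_d.
Local Notation M := 'X_{1..n}.
Variables (leM : rel M) (leS : rel (smonom d n)).
Hypotheses (admM : admissible_m leM) (admS : admissible_s leS).

Local Notation leadM v := (is_lead leM (fun m : M => v@_m)).
Local Notation leadS u :=
  (is_lead leS (fun s : smonom d n => (u 0 s.1)@_s.2)).

Lemma lmPP (v : P) : leadM v (lmP leM v).
Proof.
have := max_ofP (leM_refl admM) (leM_trans admM) (leM_total admM) (msupp v).
rewrite /lmP; case: (max_of _ _) => [m [mv mmax]|vs] /=.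
  split; first by apply/eqP; rewrite -mcoeff_msupp.
  by move=> m' /eqP; rewrite -mcoeff_msupp => /mmax.
by move=> m; apply/eqP; rewrite mcoeff_eq0 vs.
Qed.

Lemma lmPE (v : P) o : leadM v o -> lmP leM v = o.
Proof. by move=> h; apply: (is_lead_unique (leM_anti admM) (lmPP v) h). Qed.

Lemma lmPdP (u : Pd) : leadS u (lmPd leS u).
Proof.
have := max_ofP (leS_refl admS) (leS_trans admS) (leS_total admS)
  [seq (i, m) | i <- enum 'I_d, m <- msupp (u 0 i)].
have mem (s : smonom d n) : (u 0 s.1)@_s.2 <> 0 <->
    s \in [seq (i, m) | i <- enum 'I_d, m <- msupp (u 0 i)].
  case: s => i m /=; split=> [/eqP|].
    rewrite -mcoeff_msupp => mi; apply/allpairsPdep; exists i, m.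
    by rewrite mem_enum.
  by case/allpairsPdep => i' [m' [_ + [-> ->]]]; rewrite mcoeff_msupp => /eqP.
rewrite /lmPd; case: (max_of _ _) => [s [/mem sv smax]|us] /=.
  by split=> // s' /mem/smax.
by move=> s; apply/eqP/negP => /negP/eqP/mem; rewrite us.
Qed.

Lemma lmPdE (u : Pd) o : leadS u o -> lmPd leS u = o.
Proof. by move=> h; apply: (is_lead_unique (leS_anti admS) (lmPdP u) h). Qed.

Lemma lmP_eq0 (v : P) : (lmP leM v == None) = (v == 0).
Proof.
have := lmPP v; case: (lmP leM v) => [m [vm _]|v0] /=.
  by apply/esym/negP => /eqP v0; apply: vm; rewrite v0 mcoeff0.
by apply/esym/eqP/mpolyP => m; rewrite v0 mcoeff0.
Qed.

Lemma lmPd_eq0 (u : Pd) : (lmPd leS u == None) = (u == 0).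
Proof.
have := lmPdP u; case: (lmPd leS u) => [s [us _]|u0] /=.
  by apply/esym/negP => /eqP u0; apply: us; rewrite u0 mxE mcoeff0.
apply/esym/eqP/rowP => i; apply/mpolyP => m.
by have /= := u0 (i, m); rewrite mxE mcoeff0.
Qed.

Lemma lmPB (v w : P) :
  olt leM (lmP leM w) (lmP leM v) -> lmP leM (v - w) = lmP leM v.
Proof.
move=> lt; apply: lmPE.
apply: is_lead_ext (is_lead_subl _ _ _ _ (lmPP v) (lmPP w) lt);
  try by case: admM.
by move=> m; rewrite mcoeffB.
Qed.

Lemma lmPdB (v w : Pd) :
  olt leS (lmPd leS w) (lmPd leS v) -> lmPd leS (v - w) = lmPd leS v.
Proof.
move=> lt; apply: lmPdE.
apply: is_lead_ext (is_lead_subl _ _ _ _ (lmPdP v) (lmPdP w) lt);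
  try by case: admS.
by move=> m; rewrite !mxE mcoeffB.
Qed.

Lemma lmPB_lt (v w : P) m : lmP leM v = Some m -> lmP leM w = Some m ->
  v@_m = w@_m -> olt leM (lmP leM (v - w)) (Some m).
Proof.
move=> vm wm e; have := lmPP v; have := lmPP w; rewrite vm wm => hw hv.
apply: (is_lead_sub_lt _ _ _ hv hw e); try by case: admM.
by apply: is_lead_ext (lmPP (v - w)) => m'; rewrite mcoeffB.
Qed.

Lemma lmPdB_lt (v w : Pd) s : lmPd leS v = Some s -> lmPd leS w = Some s ->
  (v 0 s.1)@_s.2 = (w 0 s.1)@_s.2 -> olt leS (lmPd leS (v - w)) (Some s).
Proof.
move=> vm wm e; have := lmPdP v; have := lmPdP w; rewrite vm wm => hw hv.
apply: (is_lead_sub_lt _ _ _ hv hw e); try by case: admS.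
by apply: is_lead_ext (lmPdP (v - w)) => m'; rewrite !mxE mcoeffB.
Qed.

Lemma lmPdN (u : Pd) : lmPd leS (- u) = lmPd leS u.
Proof.
apply: lmPdE; rewrite -[X in is_lead _ _ X]omap_id.
apply: (is_lead_shift (a := -1) _ _ _ _ (lmPdP u)) => //=.
- by rewrite oppr_eq0 oner_eq0.
- by move=> s; rewrite mxE mcoeffN mulN1r.
- by move=> s _; exists s.
Qed.

Lemma mcoeffZXM (c : K) m k (v : P) :
  ((c *: 'X_[m]) * v)@_k = if (m <= k)%MM then c * v@_(k - m)%MM else 0.
Proof.
rewrite -scalerAl mcoeffZ mulrC [_ * v]mulrC; case: ifP => [mk|mk].
  by rewrite -[in LHS](submK mk) addmC mcoeffMX mulrC.
rewrite (_ : (v * 'X_[m])@_k = 0) ?mul0r //; apply/eqP.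
rewrite mcoeff_eq0 (perm_mem (msuppMX v m)); apply/negP => /mapP[m' _ km].
by rewrite km lem_addr in mk.
Qed.

Lemma lmP_mul (c : K) m (v : P) : c != 0 ->
  lmP leM ((c *: 'X_[m]) * v) = omap (mnm_add m) (lmP leM v).
Proof.
move=> c0; apply: lmPE.
apply: (is_lead_shift c0 _ _ _ (lmPP v)) => [m1 m2|m'|m'].
- exact: leM_mul.
- by rewrite mcoeffZXM lem_addr [(m + m')%MM]addmC addmK.
- by rewrite mcoeffZXM; case: ifP => // mm' _; exists (m' - m)%MM;
    rewrite addmC submK.
Qed.

Lemma lmPd_mul (c : K) m (u : Pd) : c != 0 ->
  lmPd leS ((c *: 'X_[m]) *: u) = omap (smul m) (lmPd leS u).
Proof.
move=> c0; apply: lmPdE.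
apply: (is_lead_shift c0 _ _ _ (lmPdP u)) => [s1 s2|s|s].
- exact: leS_mul.
- by rewrite mxE /= mcoeffZXM lem_addr [(m + _)%MM]addmC addmK.
- rewrite mxE mcoeffZXM; case: ifP => // ms _; exists (s.1, (s.2 - m)%MM).
  by rewrite /smul /= addmC submK //; case: s ms.
Qed.

End Leading.

(** * Monomial multiples of signatures *)

Section Smul.
Variables d n : nat.
Implicit Types (m : 'X_{1..n}) (s : smonom d n).

Lemma smulA m m' s : smul m (smul m' s) = smul (m + m')%MM s.
Proof. by rewrite /smul /= addmA. Qed.

Lemma smul0 s : smul 0%MM s = s.
Proof. by case: s => i m; rewrite /smul /= add0m. Qed.

Lemma smul_inj m : injective (@smul d n m).
Proof.
move=> [i a] [j b] e; have /= -> := congr1 fst e.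
by have /= /addmI -> := congr1 snd e.
Qed.

Lemma smul_injl s : injective (fun m => smul m s).
Proof. by move=> m m' e; have /= /addIm := congr1 snd e. Qed.

Lemma smdvdP s s' : reflect (exists m, s' = smul m s) (smdvd s s').
Proof.
case: s s' => i a [j b]; rewrite /smdvd /=; apply: (iffP andP).
  by move=> [/eqP <- ab]; exists (b - a)%MM; rewrite /smul /= submK.
by move=> [m [-> ->]]; rewrite eqxx lem_addl.
Qed.

End Smul.

(** * Cancellation and minima for compatible admissible orders *)

Section Orders.
Variables (n d : nat) (leM : rel 'X_{1..n}) (leS : rel (smonom d n)).
Hypotheses (admM : admissible_m leM) (admS : admissible_s leS).
Hypothesis compat : compatible_orders leM leS.
Implicit Types (m : 'X_{1..n}) (s : smonom d n).

(** To reflect the order, totality leaves only the reversed inequality; it is preserved by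
    multiplication, and antisymmetry with injectivity then gives equality. *)
Lemma leS_smul m s1 s2 : leS (smul m s1) (smul m s2) = leS s1 s2.
Proof.
apply/idP/idP; last exact: leS_mul.
case/orP: (leS_total admS s1 s2) => // /(leS_mul admS m) le21 le12.
have /(leS_anti admS)/smul_inj-> := introT andP (conj le12 le21).
exact: (leS_refl admS).
Qed.

Lemma leS_smull m1 m2 s : leS (smul m1 s) (smul m2 s) = leM m1 m2.
Proof.
apply/idP/idP => [le12|/(compat (leS_refl admS s))[] //].
case/orP: (leM_total admM m1 m2) => // /(compat (leS_refl admS s))[le21 _].
have /(leS_anti admS)/smul_injl-> := introT andP (conj le12 le21).
exact: (leM_refl admM).
Qed.

Lemma leM_add m m1 m2 : leM (m + m1)%MM (m + m2)%MM = leM m1 m2.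
Proof.
apply/idP/idP; last exact: leM_mul.
case/orP: (leM_total admM m1 m2) => // /(leM_mul admM m) le21 le12.
have /(leM_anti admM)/addmI-> := introT andP (conj le12 le21).
exact: (leM_refl admM).
Qed.

Lemma leM_addl m m1 : leM m1 (m + m1)%MM.
Proof.
have [->|m0] := eqVneq m 0%MM; first by rewrite add0m (leM_refl admM).
rewrite [(m + _)%MM]addmC -{1}[m1]addm0 leM_add.
by case/andP: (leM_one admM m0).
Qed.

Lemma leS_smulr m s : leS s (smul m s).
Proof.
have [->|m0] := eqVneq m 0%MM; first by rewrite smul0 (leS_refl admS).
by case/andP: (leS_one admS s m0).
Qed.

Lemma ltS_smulr m s : m != 0%MM -> ~~ leS (smul m s) s.
Proof.
move=> m0; apply/negP => le; case/andP: (leS_one admS s m0) => le' /eqP[].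
by apply: (leS_anti admS); rewrite le le'.
Qed.

(** Divisibility implies the order, so Dickson's lemma makes every sequence good. *)
Lemma leM_exists_minimum (P : 'X_{1..n} -> Prop) : (exists m, P m) ->
  exists m, P m /\ forall m', P m' -> leM m m'.
Proof.
apply: good_minimum (leM_trans admM) (leM_total admM) _ P => g.
have [i [j [ij gij]]] := dickson g; exists i, j; split=> //.
have /submK <- : (g i <= g j)%MM by apply/mnm_lepP.
exact: leM_addl.
Qed.

Lemma leS_exists_minimum (P : smonom d n -> Prop) : (exists s, P s) ->
  exists s, P s /\ forall s', P s' -> leS s s'.
Proof.
apply: good_minimum (leS_trans admS) (leS_total admS) _ P => g.
(* Recording the component and its complement to [d] makes the componentwise comparison force equal
   components. *)
pose c k (x : 'I_n + bool) : nat := match x with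
  inl x => (g k).2 x | inr true => (g k).1 | inr false => (d - (g k).1)%N end.
have [i [j [ij gij]]] := dickson c; exists i, j; split=> //.
have /smdvdP[m ->] : smdvd (g i) (g j); last exact: leS_smulr.
apply/andP; split; last by apply/mnm_lepP => x; exact: (gij (inl x)).
rewrite -val_eqE eqn_leq (gij (inr true)) /=.
by have := gij (inr false); rewrite /= leq_sub2lE // ltnW.
Qed.

End Orders.

(** * Pairs, syzygies and top reduction *)

Section PairTheory.
Variables (K : fieldType) (n d : nat) (f : 'rV[{mpoly K[n]}]_d).
Variables (leM : rel 'X_{1..n}) (leS : rel (smonom d n)).
Hypotheses (admM : admissible_m leM) (admS : admissible_s leS).

Local Notation sig := (sig leS).
Local Notation lm := (lm leM).
Implicit Types (p q r : uvec K n d) (w : mpair K n d).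
Implicit Types (s : smonom d n) (a m : 'X_{1..n}).

Lemma is_pairB p q : is_pair f p -> is_pair f q ->
  is_pair f (p.1 - q.1, p.2 - q.2).
Proof.
rewrite /is_pair /= => <- <-; rewrite -sumrB.
by apply: eq_bigr => i _; rewrite !mxE mulrBl.
Qed.

Lemma is_pair_scale (c : {mpoly K[n]}) p :
  is_pair f p -> is_pair f (pscale c p).
Proof.
rewrite /is_pair /= => <-; rewrite mulr_sumr.
by apply: eq_bigr => i _; rewrite !mxE mulrA.
Qed.

Lemma is_pair_init i : is_pair f (init_pair f i).
Proof.
rewrite /is_pair /= (bigD1 i) //= big1 ?addr0 => [|j ji].
  by rewrite mxE !eqxx mul1r.
by rewrite mxE eqxx /= (negbTE ji) mul0r.
Qed.

Lemma is_pair_sig p : is_pair f p -> lm p != None -> sig p != None.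
Proof.
rewrite /is_pair /lm /sig (lmP_eq0 admM) (lmPd_eq0 admS) => <-.
apply: contraNneq => ->; rewrite big1 // => i _.
by rewrite mxE mul0r.
Qed.

Lemma sig_pscale (c : K) m p : c != 0 ->
  sig (pscale (c *: 'X_[m]) p) = omap (smul m) (sig p).
Proof. exact: (lmPd_mul admS). Qed.

Lemma lm_pscale (c : K) m p : c != 0 ->
  lm (pscale (c *: 'X_[m]) p) = omap (mnm_add m) (lm p).
Proof. exact: (lmP_mul admM). Qed.

Lemma msigE w : msig leS w = omap (smul w.1) (sig w.2).
Proof. by rewrite /msig /mval -['X_[_]]scale1r sig_pscale ?oner_eq0. Qed.

Lemma lm_mval w : lm (mval w) = omap (mnm_add w.1) (lm w.2).
Proof. by rewrite /mval -['X_[_]]scale1r lm_pscale ?oner_eq0. Qed.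

Lemma sig_init i : sig (init_pair f i) = Some (i, 0%MM).
Proof.
apply: (lmPdE admS); split=> [|[j m]] /=; rewrite mxE eqxx /=.
  by rewrite eqxx mcoeff1 eqxx; apply/eqP; rewrite oner_eq0.
have [-> /=|_] := eqVneq j i; last by rewrite mcoeff0.
rewrite mcoeff1; case: eqP => [->|//] _; exact: (leS_refl admS).
Qed.

Lemma mval_init i : mval (init_mpair f i) = init_pair f i.
Proof. by rewrite /mval /pscale mpolyX0 scale1r mul1r. Qed.

(** Keeps of a pair only the two data that the arguments compare; [has_pair s None] says that [s] is
    a syzygy signature. *)
Definition has_pair s (o : option 'X_{1..n}) : Prop :=
  exists p, [/\ is_pair f p, sig p = Some s & lm p = o].

Lemma has_pair_mul m s o : has_pair s o ->
  has_pair (smul m s) (omap (mnm_add m) o).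
Proof.
move=> [p [pp sp lp]]; exists (mval (m, p)); split; first exact: is_pair_scale.
  by rewrite -[sig _]/(msig leS (m, p)) msigE sp.
by rewrite lm_mval lp.
Qed.

(* Subtracting the right multiple of the second pair cancels the leading
   monomial of u and keeps that of v. *)
Lemma has_pair_cancel s a o : has_pair s (Some a) -> has_pair s o ->
  olt leM o (Some a) -> exists s', ~~ leS s s' /\ has_pair s' (Some a).
Proof.
move=> [p [pp sp lp]] [q [pq sq lq]] lt.
pose cf (r : uvec K n d) := (r.1 0 s.1)@_s.2.
have cf0 r : sig r = Some s -> cf r != 0.
  by move=> sr; have := lmPdP admS r.1; rewrite -/(sig r) sr => -[/eqP].
(* The quotient of the leading coefficients of the two [u] parts, so that these cancel in the
   difference. *)
pose c := cf p / cf q.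
have c0 : c != 0 by rewrite mulf_neq0 ?invr_eq0 ?cf0.
(* ['X_[0]] is the monomial 1, inserted so that the lemmas on multiples by a term apply. *)
pose q' := pscale (c *: 'X_[0]) q.
have pq' : is_pair f q' by exact: is_pair_scale.
have sq' : sig q' = Some s by rewrite sig_pscale // sq /= smul0.
have lq' : lm q' = o.
  by rewrite lm_pscale // lq; case: o {lq lt} => //= b; rewrite add0m.
pose r : uvec K n d := (p.1 - q'.1, p.2 - q'.2).
have pr : is_pair f r by exact: is_pairB.
have lr : lm r = Some a.
  by rewrite /r /lm (lmPB admM) //= -/(lm p) -/(lm q') lp lq'.
have := is_pair_sig pr; rewrite lr => /(_ isT); case sr: (sig r) => [s'|] // _.
exists s'; split; last by exists r.
suff : olt leS (sig r) (Some s).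
  by rewrite sr (oltS (leS_refl admS) (leS_anti admS) (leS_total admS)).
apply: (lmPdB_lt admS) => //.
rewrite mxE mpolyX0 -/(cf p) -mul_mpolyC mulr1 mcoeffCM.
by rewrite /c divfK // cf0.
Qed.

(** The order on pairs asks that [a t] be smaller than [b s]. With [a = c b], cancelling [b] leaves
    the comparison of the signature [c t] with [s]. *)
Lemma top_reducibleP q r s a : is_pair f r ->
  lm q = Some a -> sig q = Some s ->
  top_reducible leM leS q r <->
  exists b t c, [/\ lm r = Some b, sig r = Some t, a = (c + b)%MM &
                    ~~ leS s (smul c t)].
Proof.
move=> pr lq sq; rewrite /top_reducible /syzygy /ltp lq sq /=.
have := is_pair_sig pr.
case lr: (lm r) => [b|] /=; last by move=> _; split=> // -[? [? [? []]]].
case sr: (sig r) => [t|] /=; last by move=> /(_ isT).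
move=> _; rewrite (oltS (leS_refl admS) (leS_anti admS) (leS_total admS)).
have key c : (a = c + b)%MM ->
    leS (smul b s) (smul a t) = leS s (smul c t).
  by move=> ->; rewrite addmC -smulA (leS_smul admS).
split=> [/andP[lt ba]|[b' [t' [c [[<-] [<-] ac lt]]]]].
  exists b, t, (a - b)%MM; split=> //; first by rewrite submK.
  by rewrite -(key (a - b)%MM) ?submK.
by rewrite (key c) // lt ac lem_addl.
Qed.

(** The subtracted multiple of [r] has the leading term of [q], which cancels, and a smaller
    signature, which leaves that of [q] in place. *)
Lemma top_reductionP q r s : is_pair f q -> is_pair f r -> sig q = Some s ->
  top_reducible leM leS q r ->
  let q' := top_reduction leM q r in
  [/\ is_pair f q', sig q' = Some s & olt leM (lm q') (lm q)].
Proof.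
move=> pq pr sq red; have : ~~ syzygy leM q by case/and4P: red.
rewrite /syzygy; case lq: (lm q) => [a|] // _.
have [b [t [c [lr sr ac lt]]]] := (top_reducibleP pr lq sq).1 red.
rewrite /top_reduction lq lr /=.
have lcq : lc leM q != 0.
  rewrite /lc lq; have := lmPP admM q.2; rewrite -/(lm q) lq.
  by case=> /eqP.
have lcr : lc leM r != 0.
  rewrite /lc lr; have := lmPP admM r.2; rewrite -/(lm r) lr.
  by case=> /eqP.
have e0 : lc leM q / lc leM r != 0 by rewrite mulf_neq0 ?invr_eq0.
have -> : (a - b)%MM = c by rewrite ac addmK.
set e := _ / _ in e0 *; pose r' := pscale (e *: 'X_[c]) r.
have sr' : sig r' = Some (smul c t) by rewrite sig_pscale // sr.
have lr' : lm r' = Some a by rewrite lm_pscale // lr ac.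
split.
- exact: (is_pairB pq (is_pair_scale _ pr)).
- rewrite /sig (lmPdB admS) //= -/(sig q) -[lmPd _ _]/(sig r') sr' sq.
  by rewrite (oltS (leS_refl admS) (leS_anti admS) (leS_total admS)).
- apply: (lmPB_lt admM) => //.
  rewrite mcoeffZXM ac lem_addr [(c + b)%MM]addmC addmK /e [(b + c)%MM]addmC.
  by move: lcr; rewrite /lc lq lr -ac => lcr; rewrite divfK.
Qed.

(** The difference of [v2 p1] and [v1 p2] is a principal syzygy; as the two signatures differ, its
    signature is their maximum. Multiples of syzygies are again syzygies. *)
Lemma gsyzygyP (D : {fset uvec K n d}) w s :
  (forall p, p \in D -> is_pair f p) -> msig leS w = Some s ->
  gsyzygy_criterion leM leS D w -> has_pair s None.
Proof.
move=> pD ws.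
have lift p : is_pair f p -> lm p = None ->
    odvd (@smdvd d n) (sig p) (msig leS w) -> has_pair s None.
  move=> pp lp; rewrite ws; case sp: (sig p) => [t|] //= /smdvdP[m ->].
  by apply: (@has_pair_mul m t None); exists p.
case=> [[p pD1 /andP[/eqP lp]]|[p1 [p2 [pD1 pD2 ne]]]].
  by apply: lift lp; exact: pD.
set q1 := pscale p2.2 p1 in ne *; set q2 := pscale p1.2 p2 in ne *.
have pq1 : is_pair f q1 by apply/is_pair_scale/pD.
have pq2 : is_pair f q2 by apply/is_pair_scale/pD.
pose q : uvec K n d := (q1.1 - q2.1, q1.2 - q2.2).
have pq : is_pair f q by exact: is_pairB.
have lq : lm q = None by apply/eqP; rewrite /lm (lmP_eq0 admM) /= mulrC subrr.
suff <- : sig q = omax leS (sig q1) (sig q2) by apply: lift.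
rewrite /omax; case: ifP => [le|/negbT lt].
  rewrite /q /sig /= -opprB (lmPdN admS) (lmPdB admS) // /olt.
  by rewrite -/(sig q1) -/(sig q2) le; apply/eqP => /esym.
rewrite /q /sig /= (lmPdB admS) //.
by rewrite (oltE (leS_refl admS) (leS_anti admS) (leS_total admS)).
Qed.

End PairTheory.

(** * M-pairs and the invariant of a run *)

Section Invariant.
Variables (K : fieldType) (n d : nat) (f : 'rV[{mpoly K[n]}]_d).
Variables (leM : rel 'X_{1..n}) (leS : rel (smonom d n)).
Hypotheses (admM : admissible_m leM) (admS : admissible_s leS).
Hypothesis compat : compatible_orders leM leS.

Local Notation sig := (sig leS).
Local Notation lm := (lm leM).
Local Notation msig := (msig leS).
Local Notation uvec := (uvec K n d).
Local Notation mpair := (mpair K n d).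
Local Notation has_pair := (has_pair f leM leS).
Implicit Types (p q r : uvec) (w : mpair) (s : smonom d n).
Implicit Types (D : {fset uvec}) (T : {fset mpair}) (S : state K n d).

Let oltSE := oltE (leS_refl admS) (leS_anti admS) (leS_total admS).
Let oltME := oltE (leM_refl admM) (leM_anti admM) (leM_total admM).
Let oleS_refl := ole_refl (leS_refl admS).
Let oleS_trans := ole_trans (leS_trans admS).

(* For equal signatures the M-pair condition prefers [w'] to [w]: a larger
   [sig w'.2] means a smaller multiplier [w'.1]. *)
Definition beats w' w : Prop :=
  olt leM (lm (mval w')) (lm (mval w)) \/
  lm (mval w') = lm (mval w) /\ ~~ leM w.1 w'.1.

Lemma msig_Some w s : msig w = Some s ->
  exists2 t, sig w.2 = Some t & s = smul w.1 t.
Proof.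
by rewrite (msigE admS); case: (sig w.2) => //= t [<-]; exists t.
Qed.

Lemma lm_mval_Some w a : lm (mval w) = Some a ->
  exists2 b, lm w.2 = Some b & a = (w.1 + b)%MM.
Proof.
by rewrite (lm_mval admM); case: (lm w.2) => //= t [<-]; exists t.
Qed.

(** Multiplying the inequality between [p] and [p'] by [m m'] turns it, as [m p] and [m' p'] share
    their signature, into one between their leading monomials. From [m t = m' t'], the larger of [t]
    and [t'] goes with the smaller multiplier. *)
Lemma Mpair_order w w' s a a' : msig w = Some s -> msig w' = Some s ->
  lm (mval w) = Some a -> lm (mval w') = Some a' ->
  [/\ ltp leM leS w.2 w'.2 = ~~ leM a' a,
      Defs.similar leM leS w.2 w'.2 = (a == a'),
      olt leS (sig w'.2) (sig w.2) = ~~ leM w'.1 w.1 &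
      equivalent leM leS w'.2 w.2 = (w.1 == w'.1) && (a == a')].
Proof.
move=> /msig_Some[t sw st] /msig_Some[t' sw' st'].
move=> /lm_mval_Some[b lw ->] /lm_mval_Some[b' lw' ->].
case: w w' sw sw' lw lw' st st' => m p [m' p'] /= sw sw' lw lw' st st'.
rewrite /ltp /Defs.similar /equivalent sw sw' lw lw' /= !oltSE /=.
have e1 : smul (m + m')%MM (smul b t') = smul (m + b)%MM s.
  by rewrite st' !smulA; congr (smul _ _); rewrite -!addmA [(m' + b)%MM]addmC.
have e2 : smul (m + m')%MM (smul b' t) = smul (m' + b')%MM s.
  rewrite st !smulA; congr (smul _ _).
  by rewrite [(m + m')%MM]addmC -!addmA [(m + b')%MM]addmC.
have ett' : leS t t' = leM m' m.
  by rewrite -(leS_smul admS m) -st st' (leS_smull admM admS compat).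
split=> //.
- by rewrite -(leS_smul admS (m + m')%MM) e1 e2 (leS_smull admM admS compat).
- apply/eqP/eqP => [/Some_inj e|e].
    by apply: (@smul_injl _ _ s); rewrite -e1 -e2 e.
  by congr Some; apply: (@smul_inj _ _ (m + m')%MM); rewrite e1 e2 e.
- by rewrite ett'.
- rewrite !(inj_eq Some_inj); have [mm'|/eqP mm'] /= := eqVneq m m'.
    rewrite -mm' in st' *; have /smul_inj -> : smul m t' = smul m t
      by rewrite -st.
    by rewrite eqxx /= [LHS]eq_sym eqm_add2l.
  apply/andP => -[/eqP tt' _]; apply: mm'; apply: (@smul_injl _ _ t).
  by rewrite -[LHS]st st' tt'.
Qed.

(** By [Mpair_order], a multiple that violates the M-pair condition is preferred in leading monomial
    or, on a tie, in multiplier. A vanishing leading monomial falls under the first alternative. *)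
Lemma not_Mpair_beaten D w s : (forall p, p \in D -> is_pair f p) ->
  w.2 \in D -> w.1 != 0%MM -> msig w = Some s -> ~ is_Mpair leM leS D w ->
  has_pair s None \/
  exists w', [/\ w'.2 \in D, msig w' = Some s & beats w' w].
Proof.
move=> pD wD w0 ws nM; apply: NNPP => /Decidable.not_or[nsyz nb]; apply: nM.
have lmw w' : w'.2 \in D -> msig w' = Some s -> exists a, lm (mval w') = Some a.
  move=> w'D sw'; case lw': (lm (mval w')) => [a|]; first by exists a.
  case: nsyz; exists (mval w'); split=> //; exact/is_pair_scale/pD.
split=> // w' w'D sw' w'0 neq.
have [a la] := lmw _ wD ws; have [a' la'] := lmw _ w'D (etrans sw' ws).
have [e1 e2 e3 e4] := Mpair_order ws (etrans sw' ws) la la'.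
rewrite e1 e2 e3; rewrite e4 in neq.
apply: contra_notT nb; rewrite negb_or negb_and !negbK => /andP[le le2].
exists w'; split=> //; first by rewrite sw'.
rewrite /beats la la'; move: le2 neq; have [->|ne] /= := eqVneq a a'.
  rewrite andbT => le' ne; right; split=> //.
  rewrite (not_leE (leM_refl admM) (leM_anti admM) (leM_total admM)).
  by rewrite le' eq_sym ne.
by move=> _ _; left; rewrite /olt /= le; apply: contra_neq ne => -[].
Qed.

(** If the two stored pairs are equivalent they coincide, and the common signature fixes the
    multiplier. Otherwise each M-pair would be strictly preferred to the other. *)
Lemma Mpair_unique D w w' : w.2 \in D -> w'.2 \in D -> msig w <> None ->
  (forall q r, q \in D -> r \in D -> sig q = sig r -> q = r) ->
  is_Mpair leM leS D w -> is_Mpair leM leS D w' -> msig w = msig w' -> w = w'.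
Proof.
move=> wD w'D; case sw: (msig w) => [s|] // _ inj [_ _ w0 Mw] [_ _ w'0 Mw'] sw'.
have [eq|neq] := boolP (equivalent leM leS w'.2 w.2).
  have e2 : w'.2 = w.2 by apply: inj => //; case/andP: eq => /eqP.
  have [t st es] := msig_Some sw; have [t' st' es'] := msig_Some (esym sw').
  rewrite e2 st in st'; case: st' => ett'; rewrite -ett' es in es'.
  have e1 := smul_injl es'.
  by case: w w' e1 e2 {wD w'D sw sw' w0 w'0 Mw Mw' eq st es es'}
    => [? ?] [? ?] /= -> ->.
have neq' : ~~ equivalent leM leS w.2 w'.2.
  by apply: contra neq; rewrite /equivalent eq_sym [lm _ == _]eq_sym.
have := Mw _ w'D (etrans (esym sw') (esym sw)) w'0 neq.
have := Mw' _ wD (etrans sw sw') w0 neq'.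
rewrite /ltp !oltSE /Defs.similar.
set x := osmul (lm w.2) _; set y := osmul (lm w'.2) _.
have oantiS := ole_anti (leS_anti admS).
have otot := ole_total (leS_total admS).
case/orP => [xy|/andP[/eqP yx s1]]; case/orP => [yx'|/andP[/eqP xy' s2]].
- by have := otot x y; rewrite (negbTE xy) (negbTE yx').
- by rewrite xy' oleS_refl in xy.
- by rewrite yx oleS_refl in yx'.
- by have := otot (sig w.2) (sig w'.2); rewrite (negbTE s1) (negbTE s2).
Qed.

Lemma Mpair_subset D D' w : (D `<=` D')%fset -> w.2 \in D ->
  is_Mpair leM leS D' w -> is_Mpair leM leS D w.
Proof.
move=> /fsubsetP sub wD [_ e w0 M]; split=> // w' /sub w'D'; exact: M.
Qed.

(* What remains true, as [DONE] grows, of a multiplied pair that has been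
   discarded, dropped, or replaced by its reduction. *)
Definition covered D w : Prop :=
  exists2 s, msig w = Some s &
  [\/ has_pair s None,
      exists w', [/\ w'.2 \in D, msig w' = Some s & beats w' w]
    | forall r, r \in D -> ~~ top_reducible leM leS (mval w) r].

Definition pending S w : Prop :=
  w \in TODO S \/ exists q, current S = Some (w, q).

Definition candidate D w : Prop :=
  initial_mpair f w \/ w.1 != 0%MM /\ w.2 \in D.

(** Asking for [q = mval w] unless the leading monomial has dropped makes a dropped [q] literally
    the value of [w], so that its irreducibility passes to [w]. *)
Definition current_ok S w q : Prop :=
  [/\ is_pair f q, sig q = msig w,
      q = mval w \/ olt leM (lm q) (lm (mval w)),
      w \notin TODO S /\
        (forall w', w' \in TODO S -> ole leS (msig w) (msig w')) &
      (forall r, r \in DONE S -> sig r <> msig w) /\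
        ~ MJ_criterion f leM leS (DONE S) w].

Record invariant S : Prop := Invariant {
  inv_pair : forall q, q \in DONE S -> is_pair f q /\ sig q <> None;
  inv_inj : forall q r, q \in DONE S -> r \in DONE S -> sig q = sig r -> q = r;
  inv_irred : forall q r, q \in DONE S -> r \in DONE S ->
    ~~ top_reducible leM leS q r;
  inv_cand : forall w, pending S w -> candidate (DONE S) w;
  inv_le : forall q w, q \in DONE S -> pending S w -> ole leS (sig q) (msig w);
  inv_used : forall q w, q \in DONE S -> w \in TODO S -> sig q = msig w ->
    ~~ initial_mpair f w /\ ~ is_Mpair leM leS (DONE S) w;
  inv_init : forall i, [\/ pending S (init_mpair f i),
    has_pair (i, 0%MM) None
    | exists2 q, q \in DONE S & sig q = Some (i, 0%MM)];
  inv_jpair : forall q r a b, q \in DONE S -> r \in DONE S ->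
    lm q = Some a -> lm r = Some b -> ltp leM leS q r ->
    let w := ((mlcm a b - a)%MM, q) in
    pending S w \/ covered (DONE S) w /\
      forall w', pending S w' -> ole leS (msig w) (msig w');
  inv_current : forall w q, current S = Some (w, q) -> current_ok S w q
}.

(** * Preservation of the invariant by each step *)

Lemma initial_mpairP w :
  reflect (exists i, w = init_mpair f i) (initial_mpair f w).
Proof.
by apply: (iffP existsP) => -[i]; [move/eqP=> ->|move=> ->]; exists i.
Qed.

Lemma invariant_init : invariant (init_state f).
Proof.
have Tinit w : pending (init_state f) w -> exists i, w = init_mpair f i.
  by case=> [/imfsetP[i _ ->]|[]//]; exists i.
split=> //.
- by move=> w /Tinit/initial_mpairP h; left.
- by move=> i; constructor 1; left; apply/imfsetP; exists i.
Qed.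

Lemma candidate_msig S w : invariant S -> candidate (DONE S) w ->
  is_pair f (mval w) /\ msig w <> None.
Proof.
move=> inv [/initial_mpairP[i ->]|[_ /(inv_pair inv)[pw sw]]].
  rewrite /Defs.msig mval_init (sig_init f admS); split=> //.
  exact: is_pair_init.
by split; [exact: is_pair_scale|rewrite (msigE admS); case: (sig w.2) sw].
Qed.

Lemma msig_init i : msig (init_mpair f i) = Some (i, 0%MM).
Proof. by rewrite /Defs.msig mval_init (sig_init f admS). Qed.

(** Separates proper multiples from initial multiplied pairs: the monomial part of [E_i] is 1, which
    has no factor other than 1. *)
Lemma msig_nontrivial w i : w.1 != 0%MM -> msig w <> Some (i, 0%MM).
Proof.
move=> w0 /msig_Some[t _ e]; case/eqP: w0.
have /= /esym/eqP := congr1 snd e.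
by move=> /eqP/mnmP h; apply/mnmP => j; have := h j; rewrite mnmDE mnm0E;
  move/eqP; rewrite addn_eq0 => /andP[/eqP].
Qed.

Local Notation top_reducible := (top_reducible leM leS).

Lemma not_MJ D w : ~ MJ_criterion f leM leS D w ->
  ~ gsyzygy_criterion leM leS D w /\
  (initial_mpair f w \/ is_Mpair leM leS D w).
Proof.
move=> nMJ; split=> [g|]; first by apply: nMJ; left.
apply: NNPP => /Decidable.not_or nM; apply: nMJ; right; exact: nM.
Qed.

Lemma invariant_select T D w : w \in T ->
  (forall w', w' \in T -> ole leS (msig w) (msig w')) ->
  ~ MJ_criterion f leM leS D w -> invariant (State T D None) ->
  invariant (State (T `\ w)%fset D (Some (w, mval w))).
Proof.
move=> wT wmin nMJ inv.
have pend w' : pending (State (T `\ w)%fset D (Some (w, mval w))) w' <->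
    pending (State T D None) w'.
  rewrite /pending /= !inE; have [->|ne] /= := eqVneq w' w.
    by split=> _; [left|right; exists (mval w)].
  by split=> [[?|[q [e _]]]|[?|[]//]]; [left|case/eqP: ne|left].
have [pw sw] : is_pair f (mval w) /\ msig w <> None.
  by apply: (candidate_msig inv); apply: (inv_cand inv); left.
split=> /=.
- exact: (inv_pair inv).
- exact: (inv_inj inv).
- exact: (inv_irred inv).
- by move=> w' /pend; exact: (inv_cand inv).
- by move=> q w' qD /pend; exact: (inv_le inv).
- by move=> q w' qD; rewrite !inE => /andP[_]; exact: (inv_used inv).
- move=> i; case: (inv_init inv i) => [/pend|h|h]; first by constructor 1.
    by constructor 2.
  by constructor 3.
- move=> q r a b qD rD lq lr lt.
  have [/pend|[cov le]] := inv_jpair inv qD rD lq lr lt.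
    by left.
  by right; split=> // w' /pend/le.
- move=> _ _ [<- <-]; split=> //=; first by left.
    by split=> [|w']; rewrite !inE ?eqxx // => /andP[_ /wmin].
  (* A stored pair with the signature of [w] would make [w] meet the Mpair Criterion. *)
  split=> // r rD /(inv_used inv rD wT)[/= /negP ni nM].
  by case: (not_MJ nMJ) => _ [].
Qed.

Lemma invariant_discard T D w : w \in T ->
  (forall w', w' \in T -> ole leS (msig w) (msig w')) ->
  MJ_criterion f leM leS D w -> invariant (State T D None) ->
  invariant (State (T `\ w)%fset D None).
Proof.
move=> wT wmin MJ inv.
have pw : pending (State T D None) w by left.
have pend w' : pending (State (T `\ w)%fset D None) w' ->
    pending (State T D None) w'.
  by case=> [|[]//]; rewrite /= !inE => /andP[_]; left.
have pend' w' : pending (State T D None) w' -> w' <> w ->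
    pending (State (T `\ w)%fset D None) w'.
  by case=> [w'T /eqP ne|[]//]; left; rewrite /= !inE ne.
have pD p : p \in D -> is_pair f p by move=> /(inv_pair inv)[].
have [pmw] := candidate_msig inv (inv_cand inv pw).
case sw: (msig w) => [s|] // _.
split=> //=.
- exact: (inv_pair inv).
- exact: (inv_inj inv).
- exact: (inv_irred inv).
- by move=> w' /pend; exact: (inv_cand inv).
- by move=> q w' qD /pend; exact: (inv_le inv).
- by move=> q w' qD; rewrite !inE => /andP[_]; exact: (inv_used inv).
- move=> i; case: (inv_init inv i) => [|h|h].
  + move=> pi; have [e|ne] := eqVneq (init_mpair f i) w; last first.
      by constructor 1; apply: pend' => //; apply/eqP.
    case: MJ => [|[ni]]; last by case: ni; apply/initial_mpairP; exists i.
    move=> g; constructor 2; apply: (gsyzygyP admM admS pD _ g).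
    by rewrite -e msig_init.
  + by constructor 2.
  + by constructor 3.
- move=> q r a b qD rD lq lr lt; have := inv_jpair inv qD rD lq lr lt.
  move=> /= [pj|[cov le]]; last by right; split=> // w' /pend/le.
  have [e|ne] := eqVneq ((mlcm a b - a)%MM, q) w; last first.
    by left; apply: pend' => //; apply/eqP.
  (* The discarded J-pair becomes covered: its signature is a syzygy signature, or another multiple
     beats it. *)
  right; rewrite e; split; last by move=> w' /pend[/wmin|[]].
  exists s => //; case: MJ => [g|[ni nM]].
    by constructor 1; apply: (gsyzygyP admM admS pD sw g).
  have [//|[w0 wD]] := inv_cand inv pw.
  have [h|h] := not_Mpair_beaten pD wD w0 sw nM.
    by constructor 1.
  by constructor 2.
Qed.

Lemma invariant_reduce T D w q r : r \in D -> top_reducible q r ->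
  invariant (State T D (Some (w, q))) ->
  invariant (State T D (Some (w, top_reduction leM q r))).
Proof.
move=> rD red inv.
have pend w' : pending (State T D (Some (w, top_reduction leM q r))) w' <->
    pending (State T D (Some (w, q))) w'.
  by split=> -[|[x [<- _]]]; [left|right; exists q|left|right; eexists].
have [pq sq lq dq mj] := inv_current inv erefl.
have pw : pending (State T D (Some (w, q))) w by right; exists q.
have [pmw] := candidate_msig inv (inv_cand inv pw).
case sw: (msig w) => [s|] // _.
have [pr _] := inv_pair inv rD; rewrite sw in sq.
have [pq' sq' lq'] := top_reductionP admM admS pq pr sq red.
split=> //=.
- exact: (inv_pair inv).
- exact: (inv_inj inv).
- exact: (inv_irred inv).
- by move=> w' /pend; exact: (inv_cand inv).
- by move=> q' w' qD /pend; exact: (inv_le inv).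
- exact: (inv_used inv).
- move=> i; case: (inv_init inv i) => [/pend|h|h]; first by constructor 1.
    by constructor 2.
  by constructor 3.
- move=> q' r' a b qD rD' lq1 lr lt.
  have [/pend|[cov le]] := inv_jpair inv qD rD' lq1 lr lt.
    by left.
  by right; split=> // w' /pend/le.
- move=> _ _ [<- <-]; split=> //=; first by rewrite sq' sw.
  right; case: lq => [<-//|]; move: lq'; rewrite !oltME => h1 h2.
  apply: contra h2 => h; apply: (ole_trans (leM_trans admM) h).
  have := ole_total (leM_total admM) (lm (top_reduction leM q r)) (lm q).
  by rewrite (negbTE h1) orbF.
Qed.

Lemma invariant_drop T D w q :
  (forall r, r \in D -> ~~ top_reducible q r) ->
  ~~ initial_pair f q && equivalent leM leS q (mval w) ->
  invariant (State T D (Some (w, q))) -> invariant (State T D None).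
Proof.
move=> irr /andP[ni /andP[/eqP es /eqP el]] inv.
have pend w' : pending (State T D None) w' -> 
    pending (State T D (Some (w, q))) w' by case=> [|[]//]; left.
have pend' w' : pending (State T D (Some (w, q))) w' -> w' <> w ->
    pending (State T D None) w'.
  by case=> [|[x [-> _]]//]; left.
have [pq sq lq [wT wmin] mj] := inv_current inv erefl.
have pw : pending (State T D (Some (w, q))) w by right; exists q.
have [pmw] := candidate_msig inv (inv_cand inv pw).
case sw: (msig w) => [s|] // _.
(* Equivalence excludes a drop of the leading monomial. *)
have qw : q = mval w.
  by case: lq => //; rewrite el /olt eqxx andbF.
split=> //=.
- exact: (inv_pair inv).
- exact: (inv_inj inv).
- exact: (inv_irred inv).
- by move=> w' /pend; exact: (inv_cand inv).
- by move=> q' w' qD /pend; exact: (inv_le inv).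
- exact: (inv_used inv).
- move=> i; case: (inv_init inv i) => [|h|h].
  + move=> pi; constructor 1; apply: pend' => // e; case/negP: ni.
    by apply/existsP; exists i; rewrite qw -e mval_init.
  + by constructor 2.
  + by constructor 3.
- move=> q' r' a b qD rD' lq1 lr lt; have := inv_jpair inv qD rD' lq1 lr lt.
  move=> /= [pj|[cov le]]; last by right; split=> // w' /pend/le.
  have [e|ne] := eqVneq ((mlcm a b - a)%MM, q') w; last first.
    by left; apply: pend' => //; apply/eqP.
  right; rewrite e; split; last by move=> w' [/wmin|[]].
  by exists s => //; constructor 3 => r /irr; rewrite qw.
Qed.

Lemma jpairsP q D w :
  reflect (exists2 r, r \in D & jpair leM leS q r = Some w)
    (w \in jpairs leM leS q D).
Proof.
by rewrite in_fset_ /= mem_pmap; apply: (iffP mapP) => -[r rD e]; exists r.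
Qed.

(** If [q] is the smaller pair, a multiplier 1 would let [r] reduce [q]. If [r] is, then [b s] is
    below [a t], hence below [L t] with [L] the lcm, and dividing by [b] puts [s] below the
    signature of the J-pair. *)
Lemma jpair_sig q r s t w : is_pair f q -> is_pair f r ->
  sig q = Some s -> sig r = Some t -> leS t s -> ~~ top_reducible q r ->
  jpair leM leS q r = Some w ->
  [/\ w.2 = q \/ w.2 = r, w.1 != 0%MM & ~~ ole leS (msig w) (Some s)].
Proof.
move=> pq pr sq sr ts irr; rewrite /jpair; case: ifP => // nsim.
case lq: (lm q) => [a|] //; case lr: (lm r) => [b|] //.
have pos w' t' : sig w'.2 = Some t' -> leS t' s ->
    ~~ ole leS (msig w') (Some s) -> w'.1 != 0%MM.
  move=> sw' t's; rewrite (msigE admS) sw' /=; apply: contraNneq => ->.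
  by rewrite smul0.
have lcmK (x y : 'X_{1..n}) : (mlcm x y - x + x)%MM = mlcm x y.
  by rewrite submK // lem_mlcml.
have lcmK' : (mlcm a b - b + b)%MM = mlcm a b by rewrite mlcmC lcmK.
case: ifP => [lt|/negbT nlt] [<-].
  suff h : ~~ ole leS (msig ((mlcm a b - a)%MM, q)) (Some s).
    split=> //=; first by left.
    by apply: (pos ((mlcm a b - a)%MM, q) s) => //; exact: (leS_refl admS).
  rewrite (msigE admS) /= sq /= (ltS_smulr admS) //.
  apply: contraNneq irr => e; apply/and4P; split=> //.
  - by rewrite /syzygy lq.
  - by rewrite /syzygy lr.
  - by rewrite lq lr /=; have := lcmK a b; rewrite e add0m => ->;
      exact: lem_mlcmr.
suff h : ~~ ole leS (msig ((mlcm a b - b)%MM, r)) (Some s).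
  by split=> //=; [right|exact: (pos ((mlcm a b - b)%MM, r) t)].
have gt : ~~ leS (smul a t) (smul b s).
  move: nlt nsim; rewrite /ltp /Defs.similar /olt lq lr sq sr /=.
  by rewrite negb_and negbK => /orP[//|->].
rewrite (msigE admS) /= sr /=; apply: contra gt => le.
have aL : (a <= mlcm a b)%MM by exact: lem_mlcml.
apply: (leS_trans admS) (_ : leS (smul (mlcm a b) t) _); last first.
  by rewrite -lcmK' addmC -smulA (leS_smul admS).
by rewrite -(submK aL) -smulA (leS_smulr admS).
Qed.

Lemma invariant_store T D w q :
  (forall r, r \in D -> ~~ top_reducible q r) ->
  invariant (State T D (Some (w, q))) ->
  invariant (State (T `|` jpairs leM leS q D)%fset (q |` D)%fset None).
Proof.
move=> irr inv.
have [pq sqw lq [wT wmin] [fresh mj]] := inv_current inv erefl.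
move: wT wmin fresh mj => /= wT wmin fresh mj.
have pw : pending (State T D (Some (w, q))) w by right; exists q.
have cw := inv_cand inv pw; have [pmw] := candidate_msig inv cw.
case sw: (msig w) => [s|] // _; have sq : sig q = Some s by rewrite sqw sw.
have sD r : r \in D -> exists2 t, sig r = Some t & leS t s.
  move=> rD; case: (inv_pair inv rD) => _; have := inv_le inv rD pw; rewrite sw.
  by case sr: (sig r) => [t|] // le _; exists t.
have pD r : r \in D -> is_pair f r by move=> /(inv_pair inv)[].
have jnew w' : w' \in jpairs leM leS q D ->
    [/\ w'.1 != 0%MM, w'.2 \in (q |` D)%fset & ~~ ole leS (msig w') (Some s)].
  move=> /jpairsP[r rD e]; have [t sr ts] := sD r rD.
  have [w'2 w'1 gt] := jpair_sig pq (pD r rD) sq sr ts (irr r rD) e.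
  by split=> //; case: w'2 => ->; rewrite !inE ?eqxx // rD orbT.
have jle w' : w' \in jpairs leM leS q D -> ole leS (Some s) (msig w').
  move=> /jnew[_ _ gt]; have := ole_total (leS_total admS) (Some s) (msig w').
  by rewrite (negbTE gt) orbF.
have subD : (D `<=` q |` D)%fset by exact: fsubsetU1.
have memD r : r \in D -> r \in (q |` D)%fset by move/(fsubsetP subD).
have qD' : q \in (q |` D)%fset by rewrite !inE eqxx.
have sle r : r \in (q |` D)%fset -> ole leS (sig r) (Some s).
  rewrite !inE => /orP[/eqP ->|/sD[t -> //]]; rewrite sq; exact: oleS_refl.
have pend w' : pending (State (T `|` jpairs leM leS q D)%fset
    (q |` D)%fset None) w' -> w' \in T \/ w' \in jpairs leM leS q D.
  by case=> [/=|[]//]; rewrite in_fsetU => /orP.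
have pendle w' : pending (State (T `|` jpairs leM leS q D)%fset
    (q |` D)%fset None) w' -> ole leS (Some s) (msig w').
  by move=> /pend[/wmin|/jle//]; rewrite sw.
have pendT w' : w' \in T -> pending (State T D (Some (w, q))) w' by left.
(* Every multiple of [q] has signature at least [s], too large to reduce a pair of signature at most
   [s]. *)
have nonred r t : sig r = Some t -> leS t s -> ~~ top_reducible r q.
  move=> sr ts; apply/negP => red.
  have : ~~ syzygy leM r by case/and4P: red.
  rewrite /syzygy; case lr: (lm r) => [a|] // _.
  have [b [t' [c [_ + _]]]] := (top_reducibleP admM admS pq lr sr).1 red.
  rewrite sq => -[<-] /negP[]; apply: (leS_trans admS ts).
  exact: (leS_smulr admS).
have irrefl r : ~~ ltp leM leS r r by rewrite /ltp /olt eqxx andbF.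
split=> /=.
- move=> r; rewrite !inE => /orP[/eqP ->|]; last exact: (inv_pair inv).
  by rewrite sq.
- move=> q1 q2; rewrite !inE => /orP[/eqP ->|q1D] /orP[/eqP -> //|q2D] e.
  + by case: (fresh q2 q2D); rewrite -e.
  + by case: (fresh q1 q1D); rewrite e.
  + exact: (inv_inj inv).
- move=> q1 q2; rewrite !inE => /orP[/eqP ->|q1D] /orP[/eqP ->|q2D].
  + by rewrite /Defs.top_reducible (negbTE (irrefl q)) !andbF.
  + exact: irr.
  + by have [t sr ts] := sD q1 q1D; exact: nonred sr ts.
  + exact: (inv_irred inv).
- move=> w' /pend[/pendT/(inv_cand inv)[|[w'0 w'D]]|/jnew[w'0 w'D _]].
  + by left.
  + by right; split=> //; exact: memD.
  + by right.
- by move=> r w' /sle rs /pendle; exact: oleS_trans rs.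
- move=> r w' rD'; rewrite in_fsetU => /orP[w'T|/jnew[_ _ gt]] e; last first.
    by have := sle r rD'; rewrite e (negbTE gt).
  have cw' := inv_cand inv (pendT _ w'T); move: rD'; rewrite !inE.
  case/orP => [/eqP rq|rD].
    rewrite rq sq in e.
    have init_eq i : w' = init_mpair f i -> False.
      move=> w'i; rewrite w'i msig_init in e.
      have /initial_mpairP[j wj] : initial_mpair f w.
        case: cw => // -[w0 _]; case: (msig_nontrivial (i := i) w0).
        by rewrite sw e.
      have : msig w = Some (i, 0%MM) by rewrite sw e.
      rewrite wj msig_init => -[ji].
      by case/negP: wT; rewrite wj ji -w'i.
    have ni : ~~ initial_mpair f w'.
      by apply/initial_mpairP => -[i]; exact: init_eq.
    split=> //; case: cw' => [|[w'0 w'D]]; first by rewrite (negbTE ni).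
    move=> /(Mpair_subset subD w'D) Mw'.
    case: (not_MJ mj) => _ [/initial_mpairP[i wi]|Mw].
      move: e; rewrite -sw wi msig_init => /esym.
      exact: msig_nontrivial.
    have wD : w.2 \in D by case: Mw.
    case/negP: wT; rewrite (Mpair_unique wD w'D _ (inv_inj inv) Mw Mw') //.
      by rewrite sw.
    by rewrite sw.
  have [ni nM] := inv_used inv rD w'T e; split=> //.
  case: cw' => [|[w'0 w'D]]; first by rewrite (negbTE ni).
  by move/(Mpair_subset subD w'D).
- move=> i; case: (inv_init inv i) => [[/= iT|[q' [e _]]]|h|[r rD sr]].
  + by constructor 1; left; rewrite /= in_fsetU iT.
  + by constructor 3; exists q => //; rewrite sqw e msig_init.
  + by constructor 2.
  + by constructor 3; exists r => //; exact: memD.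
- move=> q1 q2 a b; rewrite !inE.
  move=> /orP[/eqP ->|q1D] /orP[/eqP ->|q2D] l1 l2 lt.
  + by rewrite (negbTE (irrefl q)) in lt.
  + left; left; rewrite /= in_fsetU; apply/orP; right.
    apply/jpairsP; exists q2 => //; rewrite /jpair l1 l2 lt ifF //.
    by apply: contraTF lt; rewrite /ltp /Defs.similar /olt => ->; rewrite andbF.
  + left; left; rewrite /= in_fsetU; apply/orP; right.
    apply/jpairsP; exists q1 => //; rewrite /jpair l1 l2 mlcmC.
    have nsim : Defs.similar leM leS q q1 = false.
      apply: contraTF lt; rewrite /ltp /Defs.similar /olt eq_sym => ->.
      by rewrite andbF.
    rewrite nsim ifF //; apply/negbTE; move: lt; rewrite /ltp /olt.
    case/andP=> le ne; rewrite negb_and negbK; apply/orP; left.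
    apply/negP => le'.
    by case/eqP: ne; apply: (ole_anti (leS_anti admS)); rewrite le le'.
  have := inv_jpair inv q1D q2D l1 l2 lt; set w' := (_, q1) => /=.
  case=> [[w'T|[_ [ew _]]]|[[s' sw' cov] le]].
  + by left; left; rewrite /= in_fsetU w'T.
  (* The J-pair is the one just processed: [[1, q]] beats it by a smaller leading monomial or, on a
     tie, by its multiplier 1. *)
  + have w0 : w.1 != 0%MM.
      rewrite ew /=; apply: contraNneq (inv_irred inv q1D q2D) => e0.
      have ba : (b <= a)%MM.
        have /submK := lem_mlcml a b; rewrite e0 add0m => ->.
        exact: lem_mlcmr.
      by rewrite /Defs.top_reducible /syzygy lt l1 l2.
    right; rewrite -ew; split; last by move=> w''; rewrite sw; exact: pendle.
    exists s => //; constructor 2; exists (0%MM, q); split=> //.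
      by rewrite (msigE admS) sq /= smul0.
    have e : lm (mval (0%MM, q)) = lm q.
      by rewrite (lm_mval admM) /=; case: (lm q) => //= x; rewrite add0m.
    rewrite /beats e; case: lq => [qw|lt']; [right|by left].
    split; first by rewrite qw.
    rewrite (not_leE (leM_refl admM) (leM_anti admM) (leM_total admM)) andbC.
    exact: (leM_one admM w0).
  + right; split; last first.
      move=> w'' /pendle; apply: oleS_trans; rewrite -sw; exact: le.
    exists s' => //; case: cov => [h|[v [vD sv bv]]|h].
    - by constructor 1.
    - by constructor 2; exists v; split=> //; exact: memD.
    - constructor 3 => r; rewrite !inE => /orP[/eqP ->|/h //].
      apply: (nonred _ s') => //.
      by have := le w pw; rewrite sw' sw.
- by [].
Qed.

Lemma invariant_step S S' : step f leM leS S S' -> invariant S -> invariant S'.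
Proof.
case=> [T D w wT wmin MJ|T D w wT wmin nMJ|T D w q r rD red
  |T D w q irr eq|T D w q irr neq] inv.
- exact: invariant_discard.
- exact: invariant_select.
- exact: invariant_reduce.
- exact: invariant_drop irr eq inv.
- exact: invariant_store irr inv.
Qed.

(** * TRP pairs and terminal states *)

Local Notation is_TRP := (is_TRP f leM leS).

(** A pair with the same leading monomial and a smaller signature would reduce [p] with multiplier
    1. *)
Lemma TRP_le p s a s' : is_TRP p -> sig p = Some s -> lm p = Some a ->
  has_pair s' (Some a) -> leS s s'.
Proof.
move=> [pp _ irr] sp lp [q [pq sq lq]]; apply/negP => /negP lt.
case/negP: (irr q pq); apply/(top_reducibleP admM admS pq lp sp).
by exists a, s', 0%MM; rewrite add0m smul0.
Qed.

Lemma TRP_minimal p s a : is_pair f p -> sig p = Some s -> lm p = Some a ->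
  (forall s', has_pair s' (Some a) -> leS s s') -> is_TRP p.
Proof.
move=> pp sp lp smin; split=> // [|q pq]; first by rewrite /syzygy lp.
apply/negP => /(top_reducibleP admM admS pq lp sp)[b [t [c [lq sq ac lt]]]].
case/negP: lt; apply: smin; rewrite ac.
apply: (@has_pair_mul _ _ _ f _ _ admM admS c t (Some b)).
by exists q.
Qed.

(** Subtracting a syzygy of signature [s] would lower the signature of [p] and keep its leading
    monomial. *)
Lemma TRP_not_syzygy p s : is_TRP p -> sig p = Some s -> ~ has_pair s None.
Proof.
move=> Tp sp syz; have [pp np _] := Tp; move: np; rewrite /syzygy.
case lp : (lm p) => [a|] // _.
have hp : has_pair s (Some a) by exists p.
have [s' [lt hs']] := has_pair_cancel admM admS hp syz isT.
by rewrite (TRP_le Tp sp lp hs') in lt.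
Qed.

Definition multiple_in D p : Prop :=
  exists r c t b, [/\ r \in D, sig r = Some t, lm r = Some b,
    sig p = Some (smul c t) & lm p = Some (c + b)%MM].

(** Among all pairs with leading monomial [a], one of least signature is TRP; its signature is below
    [s], so it is a multiple of a stored pair, and that pair reduces [q]. *)
Lemma top_reducible_DONE D q s a s' :
  (forall p t, is_TRP p -> sig p = Some t -> ~~ leS s t -> multiple_in D p) ->
  (forall r, r \in D -> is_pair f r) ->
  is_pair f q -> sig q = Some s -> lm q = Some a ->
  ~~ leS s s' -> has_pair s' (Some a) ->
  exists2 r, r \in D & top_reducible q r.
Proof.
move=> IH pD pq sq lq lt hs'.
have [t [[p [pp sp lp]] tmin]] : exists t, has_pair t (Some a) /\
    forall t', has_pair t' (Some a) -> leS t t'.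
  by apply: (leS_exists_minimum admS); exists s'.
have Tp : is_TRP p by exact: TRP_minimal sp lp tmin.
have ts : ~~ leS s t.
  by apply: contra lt => st; exact: leS_trans admS _ _ _ st (tmin _ hs').
have [r [c [t' [b [rD sr lr]]]]] := IH p t Tp sp ts.
rewrite sp lp => -[e1] [e2]; exists r => //.
apply/(top_reducibleP admM admS (pD r rD) lq sq); exists b, t', c.
by rewrite -e1.
Qed.

Lemma terminal_multiple S p : invariant S -> (forall w, ~ pending S w) ->
  is_TRP p -> multiple_in (DONE S) p.
Proof.
move=> inv npend Tp; apply: NNPP => bad.
have [s [[{Tp bad}p [Tp sp bad]] smin]] : exists s,
    (exists p, [/\ is_TRP p, sig p = Some s & ~ multiple_in (DONE S) p]) /\
    forall t,
    (exists p, [/\ is_TRP p, sig p = Some t & ~ multiple_in (DONE S) p]) ->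
    leS s t.
  apply: (leS_exists_minimum admS).
  case: (Tp) => pp; rewrite /syzygy => nl _.
  have := is_pair_sig admM admS pp nl.
  by case sp: (sig p) => [s|] // _; exists s, p.
have IH q t : is_TRP q -> sig q = Some t -> ~~ leS s t ->
    multiple_in (DONE S) q.
  move=> Tq sq /negP nle; apply: NNPP => bq; apply: nle.
  by apply: smin; exists q.
have nsyz := TRP_not_syzygy Tp sp.
have nsyz' e t : s = smul e t -> ~ has_pair t None.
  move=> se h; apply: nsyz; rewrite se.
  exact: (@has_pair_mul _ _ _ f _ _ admM admS e t None).
have pD r : r \in DONE S -> is_pair f r by move=> /(inv_pair inv)[].
have [pp np _] := Tp; move: np; rewrite /syzygy; case lp : (lm p) => [a|] // _.
pose good k c := exists r t b, [/\ r \in DONE S, sig r = Some t,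
  lm r = Some b, s = smul c t & k = (c + b)%MM].
have goodI r t c : r \in DONE S -> sig r = Some t -> s = smul c t ->
    exists b, lm r = Some b /\ good (c + b)%MM c.
  move=> rD sr sc; case lr: (lm r) => [b|].
    by exists b; split=> //; exists r, t, b.
  by case: (nsyz' c t sc); exists r; split=> //; exact: pD.
have [k [[c0 gc0] kmin]] : exists k, (exists c, good k c) /\
    forall k', (exists c, good k' c) -> leM k k'.
  apply: (leM_exists_minimum admM).
  (* A first multiple comes from the unit vector of [s]: nothing is pending, and it is no syzygy
     signature, so it is stored. *)
  case: (inv_init inv s.1) => [/npend//|h|[r rD sr]].
    case: (nsyz' s.2 (s.1, 0%MM) _ h); rewrite /smul /= addm0.
    by case: (s).
  have [|b [_ g]] := goodI r (s.1, 0%MM) s.2 rD sr.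
    by rewrite /smul /= addm0; case: (s).
  by exists (s.2 + b)%MM, s.2.
have [c [[r [t [b [rD sr lr sc kc]]]] cmin]] : exists c, good k c /\
    forall c', good k c' -> leM c c'.
  by apply: (leM_exists_minimum admM); exists c0.
have hk : has_pair s (Some k).
  rewrite sc kc; apply: (@has_pair_mul _ _ _ f _ _ admM admS c t (Some b)).
  by exists r; split=> //; exact: pD.
have ha : has_pair s (Some a) by exists p.
have oltM x y : olt leM (Some x) (Some y) = ~~ leM y x by rewrite oltME.
(* Were [k] below [a], cancelling the signature of [p] with [c r] would keep [a] at a smaller
   signature, against [TRP_le]. *)
have [ka|] := boolP (leM a k); last first.
  move=> ka; have [|s' [lt hs']] := has_pair_cancel admM admS ha hk.
    by rewrite oltM.
  by rewrite (TRP_le Tp sp lp hs') in lt.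
have [ak|ak] := boolP (leM k a).
  have e : a = k by apply: (leM_anti admM); rewrite ka ak.
  by apply: bad; exists r, c, t, b; rewrite sp lp e kc sc.
(* Now [a] is below [k], and cancelling the signature of [c r] with [p] keeps [k] at a smaller
   signature; so a stored [r2] reduces [c r]. *)
have [|s' [lts hs']] := has_pair_cancel admM admS hk ha; first by rewrite oltM.
have pcr : is_pair f (mval (c, r)) by apply/is_pair_scale/pD.
have scr : sig (mval (c, r)) = Some s.
  by rewrite -[sig _]/(msig (c, r)) (msigE admS) sr sc.
have lcr : lm (mval (c, r)) = Some k by rewrite (lm_mval admM) lr kc.
have [r2 r2D] := top_reducible_DONE IH pD pcr scr lcr lts hs'.
case/(top_reducibleP admM admS (pD r2 r2D) lcr scr).
move=> b2 [t2 [c2 [lr2 sr2 kc2 lt2]]].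
(* Multiplied by [c c2], the comparison of [b t2] with [b2 t] becomes that of [k c2 t2] with [k s],
   as [c b = c2 b2 = k]. *)
have lt : ltp leM leS r r2.
  rewrite /ltp lr lr2 sr sr2 oltSE /=.
  rewrite -(leS_smul admS (c2 + c)%MM) !smulA.
  rewrite [(c2 + c)%MM]addmC -[(c + c2 + b2)%MM]addmA -kc2.
  rewrite [(c + c2)%MM]addmC -[(c2 + c + b)%MM]addmA -kc.
  by rewrite [(c2 + k)%MM]addmC [((c + k))%MM]addmC -!smulA (leS_smul admS) -sc.
set L := mlcm b b2.
have bL : (b <= L)%MM by exact: lem_mlcml.
have b2L : (b2 <= L)%MM by exact: lem_mlcmr.
have Lk : (L <= k)%MM by rewrite lem_mlcm {1}kc kc2 !lem_addl.
(* The cofactor by which the J-pair [[L / b, r]] divides [[c, r]]. *)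
set e := (k - L)%MM; have ke : k = (e + L)%MM by rewrite submK.
have ce : c = (e + (L - b))%MM.
  by apply: (@addIm _ b); rewrite -kc -addmA submK.
have c2e : c2 = (e + (L - b2))%MM.
  by apply: (@addIm _ b2); rewrite -kc2 -addmA submK.
have [/npend//|[[s1 ws1 cov] _]] := inv_jpair inv rD r2D lr lr2 lt.
rewrite (msigE admS) /= sr /= in ws1; case: ws1 => ws1.
have se : s = smul e s1 by rewrite sc ce -ws1 smulA.
have lw : lm (mval ((L - b)%MM, r)) = Some L.
  by rewrite (lm_mval admM) /= lr /= submK.
(* Multiplied by [e], a pair beating the J-pair has leading monomial below [k], or [k] itself with
   multiplier below [c]. In the last case [r2] reduces the J-pair all the same. *)
case: cov => [|[[m' p'] [/= p'D sw' bt]]|].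
- exact: nsyz' se.
- move: sw'; rewrite (msigE admS) /=; case sp': (sig p') => [t'|] //= -[s1'].
  have sem : s = smul (e + m')%MM t' by rewrite se -s1' smulA.
  have [b' [lp' g]] := goodI _ _ _ p'D sp' sem.
  have kk' := kmin _ (ex_intro _ _ g).
  move: bt; rewrite /beats lw (lm_mval admM) /= lp' /= oltM.
  move=> -[/negP|[/Some_inj eL]].
    by case; rewrite -(leM_add admM e) addmA -ke.
  case/negP; rewrite -(leM_add admM e) -ce; apply: cmin.
  by rewrite ke -eL addmA.
- move=> /(_ r2 r2D)/negP; apply.
  have sw : sig (mval ((L - b)%MM, r)) = Some s1.
    by rewrite -[sig _]/(msig ((L - b)%MM, r)) (msigE admS) /= sr /= ws1.
  apply/(top_reducibleP admM admS (pD r2 r2D) lw sw).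
  exists b2, t2, (L - b2)%MM; split=> //; first by rewrite submK.
  by rewrite -(leS_smul admS e) -se smulA -c2e.
Qed.

(** The stored [r] is itself TRP: a smaller signature for its leading monomial, multiplied by [c],
    would contradict that [p] is TRP. As [r] is similar to [p], the TRB condition leaves only
    [c = 1]. *)
Lemma terminal_TRB S p : invariant S -> (forall w, ~ pending S w) ->
  is_TRB f leM leS p -> exists2 q, q \in DONE S & equivalent leM leS q p.
Proof.
move=> inv npend [Tp TRBp].
have [r [c [t [b [rD sr lr sp lp]]]]] := terminal_multiple inv npend Tp.
have [pr _] := inv_pair inv rD.
have Tr : is_TRP r.
  apply: TRP_minimal sr lr _ => // s' h; rewrite -(leS_smul admS c).
  apply: TRP_le Tp sp lp _.
  exact: (@has_pair_mul _ _ _ f _ _ admM admS c s' (Some b)).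
have /TRBp/(_ _) : is_TRP r by [].
rewrite /Defs.similar lr lp sr sp /= smulA [(b + c)%MM]addmC eqxx => /(_ isT).
rewrite /proper_smdvd negb_and negbK => /orP[/smdvdP[]|/eqP e].
  by exists c.
exists r => //; rewrite /equivalent sr lr sp lp -e eqxx /=.
rewrite -[t in LHS]smul0 in e.
by have -> : c = 0%MM; [rewrite (smul_injl e)|rewrite add0m].
Qed.

(** * Termination *)

Definition divides r q : Prop :=
  exists t s, [/\ sig r = Some t, sig q = Some s, smdvd t s &
  match lm r, lm q with
  | Some b, Some a => (b <= a)%MM | None, None => True | _, _ => False end].

(* Both [i] and [d - i] are recorded for the component [i], and both truth
   values of [lm q = 0], so that the componentwise order forces equality. *)
Definition exponents q (x : 'I_n + 'I_n + 'I_4) : nat :=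
  match x with
  | inl (inl i) => oapp (fun m : 'X_{1..n} => m i) 0%N (lm q)
  | inl (inr i) => oapp (fun s : smonom d n => s.2 i) 0%N (sig q)
  | inr k => nth 0%N [:: oapp (fun s : smonom d n => s.1 : nat) 0%N (sig q);
      oapp (fun s : smonom d n => (d - s.1)%N) 0%N (sig q);
      nat_of_bool (lm q == None); nat_of_bool (lm q != None)] k
  end.

Lemma exponents_divides q r : sig q <> None -> sig r <> None ->
  (forall x, (exponents r x <= exponents q x)%N) -> divides r q.
Proof.
case sq: (sig q) => [s|] // _; case sr: (sig r) => [t|] // _ le.
exists t, s; split=> //.
  apply/andP; split.
    have := le (inr (@Ordinal 4 0 isT)); have := le (inr (@Ordinal 4 1 isT)).
    rewrite /= sq sr /= => le1 le0; rewrite -val_eqE eqn_leq le0 /=.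
    by move: le1; rewrite leq_sub2lE // ltnW.
  by apply/mnm_lepP => i; have := le (inl (inr i)); rewrite /= sq sr.
have := le (inr (@Ordinal 4 2 isT)); have := le (inr (@Ordinal 4 3 isT)).
have : forall i,
  (exponents r (inl (inl i)) <= exponents q (inl (inl i)))%N by [].
rewrite /=; case: (lm r) (lm q) => [b|] [a|] //= h _ _.
by apply/mnm_lepP => i; exact: h.
Qed.

Lemma store_not_divides T D w q : invariant (State T D (Some (w, q))) ->
  (forall r, r \in D -> ~~ top_reducible q r) ->
  ~~ (~~ initial_pair f q && equivalent leM leS q (mval w)) ->
  forall r, r \in D -> ~ divides r q.
Proof.
move=> inv irr keep r rD [t [s [sr sq /smdvdP[c sc] dv]]].
have [pq sqw lq _ [/= fresh mj]] := inv_current inv erefl.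
have [nsyz Mw] := not_MJ mj.
have pw : pending (State T D (Some (w, q))) w by right; exists q.
have sw : msig w = Some s by rewrite -sqw.
have [pr _] := inv_pair inv rD.
(* If both leading monomials vanish, [w] would have met the GSyzygy Criterion. *)
case lr: (lm r) dv => [b|]; last first.
  case lq' : (lm q) => // _; apply: nsyz; left; exists r => //.
  by rewrite /syzygy lr eqxx sr sw /=; apply/smdvdP; exists c.
case lq' : (lm q) => [a|] // ba.
have c0 : c != 0%MM.
  by apply: contra_notN (fresh r rD) => /eqP c0; rewrite sr sw sc c0 smul0.
have ninit : ~~ initial_mpair f w.
  apply/initial_mpairP => -[i wi].
  case: (msig_nontrivial (w := (c, r)) (i := i) c0).
  by rewrite (msigE admS) sr /= -sc -sw wi msig_init.
case: Mw => [|Mw]; first by rewrite (negbTE ninit).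
have ninitq : ~~ initial_pair f q.
  apply/existsP => -[i /eqP qi].
  case: (msig_nontrivial (w := (c, r)) (i := i) c0).
  by rewrite (msigE admS) sr /= -sc -sq qi (sig_init f admS).
have {ba} /submK ba := ba; set e := (a - b)%MM in ba.
(* Otherwise [e r] would have the leading monomial of [q] and a smaller signature, so [r] would
   reduce [q]. *)
have ce : leM c e.
  rewrite -(leS_smull admM admS compat _ _ t) -sc.
  apply: contraNT (irr r rD) => lt.
  by apply/(top_reducibleP admM admS pr lq' sq); exists b, t, e.
case la: (lm (mval w)) lq => [a'|] lq; last first.
  by case: lq => [qw|]; [rewrite -qw lq' in la|rewrite lq' oltME].
have lcr : lm (mval (c, r)) = Some (c + b)%MM by rewrite (lm_mval admM) lr.
have scr : msig (c, r) = Some s by rewrite (msigE admS) sr /= -sc.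
have [e1 e2 e3 e4] := Mpair_order sw scr la lcr.
have a'c : leM a' (c + b)%MM.
  have [|ne] := boolP (equivalent leM leS r w.2).
    by rewrite e4 => /andP[_ /eqP ->]; exact: (leM_refl admM).
  case: Mw => _ _ _ /(_ (c, r) rD (etrans scr (esym sw)) c0 ne).
  rewrite e1 e2 => /orP[nle|/andP[/eqP -> _]]; last exact: (leM_refl admM).
  by have := leM_total admM a' (c + b)%MM; rewrite (negbTE nle) orbF.
have a'a : leM a' a.
  apply: (leM_trans admM a'c); rewrite -ba ![(_ + b)%MM]addmC.
  by rewrite (leM_add admM).
(* The value of [w] has leading monomial at most [c b], hence at most [e b = a]; so no drop occurred
   and [q] is that value. *)
case: lq => [qw|]; last by rewrite lq' oltME /= a'a.
case/negP: keep; rewrite ninitq /=.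
by rewrite qw /equivalent !eqxx.
Qed.

Lemma step_DONE S S' : step f leM leS S S' -> invariant S ->
  DONE S' = DONE S \/
  exists q, [/\ DONE S' = (q |` DONE S)%fset, sig q <> None &
    q \notin DONE S /\ forall r, r \in DONE S -> ~ divides r q].
Proof.
case=> [T D w wT wmin MJ|T D w wT wmin nMJ|T D w q r rD red
  |T D w q irr eq|T D w q irr keep] inv; try by left.
right; exists q; have [pq sq _ _ [/= fresh _]] := inv_current inv erefl.
have pw : pending (State T D (Some (w, q))) w by right; exists q.
have [_ sw] := candidate_msig inv (inv_cand inv pw).
split=> //; first by rewrite sq.
by split; [apply/negP => /fresh; apply|exact: (store_not_divides inv irr keep)].
Qed.

Lemma step_DONE_eq S S' : step f leM leS S S' -> invariant S ->
  DONE S' = DONE S ->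
  (#|` TODO S'| < #|` TODO S|)%N \/
  #|` TODO S'| = #|` TODO S| /\
  exists w q, current S = Some (w, q) /\ (current S' = None \/
    exists q', current S' = Some (w, q') /\ olt leM (lm q') (lm q)).
Proof.
case=> [T D w wT wmin MJ|T D w wT wmin nMJ|T D w q r rD red
  |T D w q irr eq|T D w q irr keep] inv /= eD.
- by left; rewrite (cardfsD1 w T) wT.
- by left; rewrite (cardfsD1 w T) wT.
- right; split=> //; exists w, q; split=> //; right; eexists; split=> //.
  have [pq sq _ _ _] := inv_current inv erefl; have [pr _] := inv_pair inv rD.
  have pw : pending (State T D (Some (w, q))) w by right; exists q.
  have [_] := candidate_msig inv (inv_cand inv pw).
  rewrite -sq; case sq': (sig q) => [s|] // _.
  by case: (top_reductionP admM admS pq pr sq' red).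
- by right; split=> //; exists w, q; split=> //; left.
- have [_ _ _ _ [/= fresh _]] := inv_current inv erefl.
  have [_ sq _ _ _] := inv_current inv erefl.
  by case: (fresh q) => //; rewrite -eD !inE eqxx.
Qed.

Lemma step_progress S : invariant S ->
  (forall S', ~ step f leM leS S S') -> forall w, ~ pending S w.
Proof.
case: S => T D [[w q]|] inv stuck.
  case: (classic (exists2 r, r \in D & top_reducible q r)) => [[r rD red]|nred].
    by case: (stuck _ (StepReduce f T w rD red)).
  have irr r : r \in D -> ~~ top_reducible q r.
    by move=> rD; apply/negP => red; apply: nred; exists r.
  have [h|h] := boolP (~~ initial_pair f q && equivalent leM leS q (mval w)).
    by case: (stuck _ (StepDrop T irr h)).
  by case: (stuck _ (StepStore T irr h)).
move=> w [/= wT|[]//].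
have sT w' : w' \in T -> exists s, msig w' = Some s.
  move=> w'T; have pw : pending (State T D None) w' by left.
  have [_] := candidate_msig inv (inv_cand inv pw).
  by case: (msig w') => [s|] // _; exists s.
have [s [[w0 [w0T sw0]] smin]] : exists s,
    (exists w, w \in T /\ msig w = Some s) /\
    forall t, (exists w, w \in T /\ msig w = Some t) -> leS s t.
  apply: (leS_exists_minimum admS).
  by have [s sw] := sT w wT; exists s, w.
have w0min w' : w' \in T -> ole leS (msig w0) (msig w').
  move=> w'T; have [t st] := sT w' w'T; rewrite sw0 st; apply: smin.
  by exists w'.
case: (classic (MJ_criterion f leM leS D w0)) => MJ.
  exact: stuck (StepDiscard w0T w0min MJ).
exact: stuck (StepSelect w0T w0min MJ).
Qed.

Section Run.
Variable st : nat -> state K n d.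
Hypothesis st_step : forall k, step f leM leS (st k) (st k.+1).
Hypothesis st_inv : forall k, invariant (st k).

Lemma DONE_eventually_constant :
  exists N, forall k, (N <= k)%N -> DONE (st k.+1) = DONE (st k).
Proof.
apply: NNPP => nconst.
have next N : exists kq : nat * uvec, [/\ (N <= kq.1)%N,
    kq.2 \in DONE (st kq.1.+1), sig kq.2 <> None &
    forall r, r \in DONE (st kq.1) -> ~ divides r kq.2].
  apply: NNPP => nex; apply: nconst; exists N => k Nk.
  case: (step_DONE (st_step k) (st_inv k)) => // -[q [e sq [_ ndv]]].
  by case: nex; exists (k, q); split=> //=; rewrite e !inE eqxx.
pose F N := constructive_indefinite_description _ (next N).
(* Strictly increasing storing times, each with the pair stored then. *)
pose h := fix h i := if i is i'.+1 then sval (F (h i').1.+1) else sval (F 0%N).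
have hP i : [/\ (h i).2 \in DONE (st (h i).1.+1), sig (h i).2 <> None &
    forall r, r \in DONE (st (h i).1) -> ~ divides r (h i).2].
  by case: i => [|i] /=; [case: (svalP (F 0%N))|case: (svalP (F (h i).1.+1))].
have hS i : ((h i).1 < (h i.+1).1)%N by case: (svalP (F (h i).1.+1)).
have DONE_mono :
    {homo (fun k => DONE (st k)) : i j / (i <= j)%N >-> (i `<=` j)%fset}.
  apply: homo_leq => [D|D1 D2 D3|k]; first exact: fsubset_refl.
    exact: fsubset_trans.
  case: (step_DONE (st_step k) (st_inv k)) => [->|[q [-> _ _]]].
    exact: fsubset_refl.
  exact: fsubsetU1.
have [i [j [ij le]]] := dickson (fun i => exponents (h i).2).
have hij : ((h i).1 < (h j).1)%N.
  suff hlt : {homo (fun i => (h i).1) : i j / (i < j)%N} by exact: hlt.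
  by apply: homo_ltn => //; exact: ltn_trans.
have [qi si _] := hP i; have [_ sj ndv] := hP j.
apply: (ndv (h i).2); first by apply: (fsubsetP (DONE_mono _ _ hij)).
exact: exponents_divides.
Qed.

Lemma run_not_infinite : False.
Proof.
have [N DN] := DONE_eventually_constant.
have [k0 [Nk0 kmin]] := tail_minimum (fun k => #|` TODO (st k)|) N.
have DN' j : DONE (st (k0 + j).+1) = DONE (st (k0 + j)%N).
  by apply: DN; exact: leq_trans Nk0 (leq_addr _ _).
have card j : #|` TODO (st (k0 + j)%N)| = #|` TODO (st k0)|.
  elim: j => [|j IHj]; first by rewrite addn0.
  apply/eqP; rewrite eqn_leq kmin ?leq_addr // andbT -IHj addnS.
  by case: (step_DONE_eq (st_step _) (st_inv _) (DN' j)) => [/ltnW|[->]].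
have cur j : exists w q, current (st (k0 + j)%N) = Some (w, q) /\
    (current (st (k0 + j).+1) = None \/ exists q',
      current (st (k0 + j).+1) = Some (w, q') /\ olt leM (lm q') (lm q)).
  case: (step_DONE_eq (st_step _) (st_inv _) (DN' j)) => [|[_ //]].
  by rewrite -addnS !card ltnn.
have red j : exists w q q', [/\ current (st (k0 + j)%N) = Some (w, q),
    current (st (k0 + j.+1)%N) = Some (w, q') & olt leM (lm q') (lm q)].
  have [w [q [e [e'|[q' [e' lt]]]]]] := cur j; last first.
    by exists w, q, q'; rewrite addnS.
  (* A drop leaves no current pair, whereas [cur] provides one at the next index. *)
  by have [w' [q' []]] := cur j.+1; rewrite addnS e'.
have red_Some j w q : current (st (k0 + j)%N) = Some (w, q) ->
    exists m, lm q = Some m.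
  have [w' [q1 [q' [-> _ + [_ <-]]]]] := red j.
  by case: (lm q1) => [m|]; [exists m|rewrite oltME].
have [m [[j [w [q [e lq]]]] mmin]] : exists m,
    (exists j w q, current (st (k0 + j)%N) = Some (w, q) /\ lm q = Some m) /\
    forall m', (exists j w q,
      current (st (k0 + j)%N) = Some (w, q) /\ lm q = Some m') -> leM m m'.
  apply: (leM_exists_minimum admM); have [w [q [q' [e _ _]]]] := red 0%N.
  by have [m lq] := red_Some _ _ _ e; exists m, 0%N, w, q.
have [w' [q1 [q' [e1 e']]]] := red j; move: e1; rewrite e => -[_ <-].
have [m' lq'] := red_Some _ _ _ e'.
rewrite lq lq' oltME /= mmin //.
by exists j.+1, w', q'.
Qed.

End Run.

Lemma step_invariants (st : nat -> state K n d) :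
  TRBMJ_run f leM leS st -> forall k, invariant (st k).
Proof.
move=> [st0 stS]; elim=> [|k IHk].
  by rewrite st0; exact: invariant_init.
by case: (stS k) => [/invariant_step|[_ ->]]; first exact.
Qed.

End Invariant.

Theorem proposition15 (K : fieldType) (n d : nat)
    (f : 'rV[{mpoly K[n]}]_d)
    (leM : rel 'X_{1..n}) (leS : rel (smonom d n))
    (admM : admissible_m leM) (admS : admissible_s leS)
    (compat : compatible_orders leM leS)
    (st : nat -> state K n d) (run : TRBMJ_run f leM leS st)
    (p : uvec K n d) (TRBp : is_TRB f leM leS p) :
  exists N : nat, forall k : nat, (N <= k)%N ->
    exists2 q : uvec K n d, q \in DONE (st k) & equivalent leM leS q p.
Proof.
have inv := step_invariants admM admS compat run; have [_ stS] := run.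
have [N stuck] : exists N, forall S, ~ step f leM leS (st N) S.
  apply: NNPP => nstuck; apply: (run_not_infinite admM admS compat _ inv) => k.
  by case: (stS k) => // -[stuck _]; case: nstuck; exists k.
(* From a stuck state the run can only stutter. *)
exists N => k Nk; have -> : st k = st N.
  rewrite -(subnK Nk); elim: (k - N)%N => // j IHj; rewrite addSn.
  by case: (stS (j + N)%N) => [|[_ ->//]]; rewrite IHj => /stuck.
have npend := step_progress admS (inv N) stuck.
exact: terminal_TRB (inv N) npend TRBp.
Qed.
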